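(* Let $\mathbf{k}$ be a commutative ring with unit. For $i=0,1$ the square of categories and functors formed by $\mathtt{J}'_i\colon\mathbf{Lb}\to\mathbf{XLb}$, $\mathtt{XU_d}\colon\mathbf{XLb}\to\mathbf{XDias}$, $\mathtt{U_d}\colon\mathbf{Lb}\to\mathbf{Dias}$ and $\mathtt{J}_i\colon\mathbf{Dias}\to\mathbf{XDias}$ is commutative, i.e. $\mathtt{XU_d}\circ\mathtt{J}'_i$ and $\mathtt{J}_i\circ\mathtt{U_d}$ are equal or naturally isomorphic functors $\mathbf{Lb}\to\mathbf{XDias}$.
   Context: All algebras are over a fixed commutative ring $\mathbf{k}$ with unit. A square of functors is called commutative if the two composites are equal or naturally isomorphic. **Dialgebras.** A dialgebra is a $\mathbf{k}$-module $D$ with two $\mathbf{k}$-bilinear products $\dashv,\vdash$ such that for all $x,y,z$: (1) $(x\dashv y)\dashv z=x\dashv(y\vdash z)$; (2) $(x\dashv y)\dashv z=x\dashv(y\dashv z)$; (3) $(x\vdash y)\dashv z=x\vdash(y\dashv z)$; (4) $(x\dashv y)\vdash z=x\vdash(y\vdash z)$; (5) $(x\vdash y)\vdash z=x\vdash(y\vdash z)$. Morphisms are linear maps preserving both products; the category is $\mathbf{Dias}$. An ideal is a submodule $I$ such that $x\dashv y,x\vdash y,y\dashv x,y\vdash x\in I$ for all $x\in I$, $y\in D$. An action of a dialgebra $D$ on a dialgebra $L$ consists of four bilinear maps $\dashv,\vdash\colon D\otimes L\to L$ and $\dashv,\vdash\colon L\otimes D\to L$ satisfying the 30 equalities obtained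 from (1)–(5) by taking one variable in $D$ and two in $L$ (15 equalities), or one variable in $L$ and two in $D$ (15 equalities). A crossed module of dialgebras is a dialgebra homomorphism $\mu\colon L\to D$ with an action of $D$ on $L$ such that, for $\star\in\{\dashv,\vdash\}$, $x\in D$, $l,l'\in L$: $\mu(x\star l)=x\star\mu(l)$, $\mu(l\star x)=\mu(l)\star x$, $\mu(l)\star l'=l\star l'=l\star\mu(l')$. A morphism $(L\xrightarrow{\mu}D)\to(L'\xrightarrow{\mu'}D')$ is a pair of dialgebra homomorphisms $\alpha\colon L\to L'$, $\beta\colon D\to D'$ with $\mu'\alpha=\beta\mu$, $\alpha(x\star l)=\beta(x)\star\alpha(l)$, $\alpha(l\star x)=\alpha(l)\star\beta(x)$. The category is $\mathbf{XDias}$. **Leibniz algebras.** A Leibniz algebra is a $\mathbf{k}$-module $\mathfrak g$ with a bilinear bracket satisfying $[x,[y,z]]=[[x,y],z]-[[x,z],y]$; the category is $\mathbf{Lb}$. A Leibniz action of $\mathfrak g$ on $\mathfrak q$ consists of bilinear maps $[\,,]\colon\mathfrak g\otimes\mathfrak q\to\mathfrak q$, $[\,,]\colon\mathfrak q\otimes\mathfrak g\to\mathfrak q$ satisfying the 6 equalities obtained from the Leibniz identity by taking one variable in $\mathfrak g$ and two in $\mathfrak q$, or one in $\mathfrak q$ and two in $\mathfrak g$. The semi-direct product $\mathfrak q\rtimes\mathfrak g$ is $\mathfrak q\oplus\mathfrak g$ with $[(q,g),(q',g')]=([q,q']+[q,g']+[g,q'],[g,g'])$. A Leibniz crossed module is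 a Leibniz homomorphism $\nu\colon\mathfrak q\to\mathfrak g$ with a Leibniz action of $\mathfrak g$ on $\mathfrak q$ such that $\nu[g,q]=[g,\nu(q)]$, $\nu[q,g]=[\nu(q),g]$, $[\nu(q),q']=[q,q']=[q,\nu(q')]$. A morphism $(\mathfrak q\xrightarrow{\nu}\mathfrak g)\to(\mathfrak q'\xrightarrow{\nu'}\mathfrak g')$ is a pair of Leibniz homomorphisms $\alpha\colon\mathfrak q\to\mathfrak q'$, $\beta\colon\mathfrak g\to\mathfrak g'$ with $\nu'\alpha=\beta\nu$, $\alpha[g,q]=[\beta(g),\alpha(q)]$, $\alpha[q,g]=[\alpha(q),\beta(g)]$. The category is $\mathbf{XLb}$. **Functors.** $\mathtt{J}_0(D)=(0\to D)$, $\mathtt{J}_1(D)=(D\xrightarrow{\mathrm{id}}D)$ for a dialgebra $D$ (with $D$ acting on itself by its products); $\mathtt{J}'_0(\mathfrak g)=(0\to\mathfrak g)$, $\mathtt{J}'_1(\mathfrak g)=(\mathfrak g\xrightarrow{\mathrm{id}}\mathfrak g)$ for a Leibniz algebra $\mathfrak g$ (with $\mathfrak g$ acting on itself by its bracket). $\mathtt{U_d}\colon\mathbf{Lb}\to\mathbf{Dias}$ (universal enveloping dialgebra) sends $\mathfrak g$ to the quotient of the free dialgebra on the $\mathbf{k}$-module $\mathfrak g$ by the ideal generated by all $[x,y]-x\dashv y+y\vdash x$, $x,y\in\mathfrak g$. For a Leibniz crossed module $\nu\colon\mathfrak q\to\mathfrak g$, let $s,t\colon\mathfrak q\rtimes\mathfrak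 g\to\mathfrak g$, $s(q,g)=g$, $t(q,g)=\nu(q)+g$. Let $X\subseteq\mathtt{U_d}(\mathfrak q\rtimes\mathfrak g)$ be $$X=\operatorname{Ker}\mathtt{U_d}(s)\dashv\operatorname{Ker}\mathtt{U_d}(t)+\operatorname{Ker}\mathtt{U_d}(t)\dashv\operatorname{Ker}\mathtt{U_d}(s)+\operatorname{Ker}\mathtt{U_d}(s)\vdash\operatorname{Ker}\mathtt{U_d}(t)+\operatorname{Ker}\mathtt{U_d}(t)\vdash\operatorname{Ker}\mathtt{U_d}(s)$$ (each term is the $\mathbf{k}$-span of the products). Let $\overline{\mathtt{U_d}}(s),\overline{\mathtt{U_d}}(t)\colon\mathtt{U_d}(\mathfrak q\rtimes\mathfrak g)/X\to\mathtt{U_d}(\mathfrak g)$ be the induced homomorphisms. $\mathtt{U_d}(\mathfrak g)$ is regarded as a subdialgebra of $\mathtt{U_d}(\mathfrak q\rtimes\mathfrak g)/X$ via the map induced by $g\mapsto(0,g)$. Then $\mathtt{XU_d}(\mathfrak q\xrightarrow{\nu}\mathfrak g)$ is the crossed module of dialgebras $$\overline{\mathtt{U_d}}(t)|_{\operatorname{Ker}\overline{\mathtt{U_d}}(s)}\colon\operatorname{Ker}\overline{\mathtt{U_d}}(s)\to\mathtt{U_d}(\mathfrak g),$$ with $\mathtt{U_d}(\mathfrak g)$ acting on $\operatorname{Ker}\overline{\mathtt{U_d}}(s)$ by the products of $\mathtt{U_d}(\mathfrak q\rtimes\mathfrak g)/X$. On a morphism $(\alpha,\beta)$, $\mathtt{XU_d}$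 is induced by $\mathtt{U_d}(\alpha\times\beta)$ and $\mathtt{U_d}(\beta)$. *)

(* Defs.v *)
From HB Require Import structures.
From mathcomp Require Import ssrAC all_boot all_algebra generic_quotient ring_quotient.
From mathcomp Require Import boolp classical_sets.

Set Implicit Arguments.
Unset Strict Implicit.
Unset Printing Implicit Defensive.

Import GRing.Theory.
Local Open Scope classical_set_scope.
Local Open Scope ring_scope.

Record category := Category {
  obj :> Type;
  hom : obj -> obj -> Type;
  idc : forall A, hom A A;
  compc : forall A B C, hom B C -> hom A B -> hom A C;
  compcA : forall A B C D (h : hom C D) (g : hom B C) (f : hom A B),
    compc h (compc g f) = compc (compc h g) f;
  compc1l : forall A B (f : hom A B), compc (idc B) f = f;
  compc1r : forall A B (f : hom A B), compc f (idc A) = f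
}.
Arguments idc {c} A.
Arguments compc {c A B C}.

Record functor (C D : category) := Functor {
  fobj :> C -> D;
  fmap : forall A B, hom A B -> hom (fobj A) (fobj B);
  fmap_id : forall A, fmap (idc A) = idc (fobj A);
  fmap_comp : forall A B E (g : hom B E) (f : hom A B),
    fmap (compc g f) = compc (fmap g) (fmap f)
}.
Arguments fmap {C D} _ {A B} _.

Section FunctorComp.
Variables (C D E : category) (G : functor D E) (F : functor C D).

Lemma fcomp_id A : fmap G (fmap F (idc A)) = idc (G (F A)).
Proof. by rewrite !fmap_id. Qed.

Lemma fcomp_comp A B H (g : hom B H) (f : hom A B) :
  fmap G (fmap F (compc g f)) = compc (fmap G (fmap F g)) (fmap G (fmap F f)).
Proof. by rewrite !fmap_comp. Qed.

Definition fcomp : functor C E := Functor fcomp_id fcomp_comp.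

End FunctorComp.

Definition is_iso (C : category) (A B : C) (f : hom A B) :=
  exists g : hom B A, compc g f = idc A /\ compc f g = idc B.

Definition naturally_isomorphic (C D : category) (F G : functor C D) :=
  exists eta : forall A : C, hom (F A) (G A),
    (forall A, is_iso (eta A)) /\
    (forall A B (f : hom A B),
       compc (eta B) (fmap F f) = compc (fmap G f) (eta A)).

(* The two composites A -> D are G after F (through B) and G' after F'
   (through C). *)
Definition commutative_square (A B C D : category)
    (F : functor A B) (G : functor B D)
    (F' : functor A C) (G' : functor C D) :=
  fcomp G F = fcomp G' F' \/ naturally_isomorphic (fcomp G F) (fcomp G' F').

Section Modules.
Variable k : comPzRingType.
Implicit Types U V W : lmodType k.

(* The library's [bilinear_for] requires the scalars to be a nontrivial ring. *)
Definition bilinear_op U V W (f : U -> V -> W) :=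
  (forall v, linear (f^~ v)) /\ (forall u, linear (f u)).

Lemma linear_eq U V (f g : {linear U -> V}) : f =1 g -> f = g.
Proof.
case: f => f [[fD] [fZ]]; case: g => g cg /= fg.
have {}fg : f = g by apply: funext.
subst g; case: cg => [[gD] [gZ]].
by rewrite (Prop_irrelevance gD fD) (Prop_irrelevance gZ fZ).
Qed.

Definition kspan U (S : set U) : set U :=
  smallest (fun A : set U => submod_closed (mem A)) S.

Definition setadd U (A B : set U) : set U := [set x + y | x in A & y in B].

Lemma submod_closedE U (A : set U) : submod_closed (mem A) <->
  A 0 /\ forall a u v, A u -> A v -> A (a *: u + v).
Proof.
split=> [[A0 AP]|[A0 AP]]; split.
- by have := A0; rewrite inE.
- move=> a u v Au Av.
  by have := AP a u v; rewrite !inE; apply.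
- by rewrite inE.
- by move=> a u v; rewrite !inE; apply: AP.
Qed.

Lemma kspan_submod U (S : set U) : submod_closed (mem (kspan S)).
Proof.
apply/submod_closedE; split=> [A [/submod_closedE[]]//|a u v Su Sv A AP].
have [/submod_closedE[_ Ac] _] := AP.
by apply: Ac; [exact: Su|exact: Sv].
Qed.

Lemma kspan_sub U (S : set U) (A : set U) :
  submod_closed (mem A) -> S `<=` A -> kspan S `<=` A.
Proof. exact: smallest_sub. Qed.

Lemma setadd_submod U (A B : set U) : submod_closed (mem A) ->
  submod_closed (mem B) -> submod_closed (mem (setadd A B)).
Proof.
move=> /submod_closedE[A0 AP] /submod_closedE[B0 BP]; apply/submod_closedE; split.
  by exists 0 => //; exists 0 => //; rewrite addr0.
move=> a _ _ [x Ax [y By <-]] [x' Ax' [y' By' <-]].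
exists (a *: x + x'); first exact: AP.
by exists (a *: y + y'); [exact: BP | rewrite scalerDr addrACA].
Qed.

End Modules.

Section UnitModule.

Let unit_add (_ _ : unit) := tt.
Let unit_opp (_ : unit) := tt.

Let unit_addA : associative unit_add. Proof. by []. Qed.
Let unit_addC : commutative unit_add. Proof. by []. Qed.
Let unit_add0 : left_id tt unit_add. Proof. by case. Qed.
Let unit_addN : left_inverse tt unit_opp unit_add. Proof. by []. Qed.

HB.instance Definition _ := GRing.isZmodule.Build unit
  unit_addA unit_addC unit_add0 unit_addN.

Variable k : pzRingType.

Let unit_scale (_ : k) (_ : unit) := tt.

Let unit_scaleA a b v : unit_scale a (unit_scale b v) = unit_scale (a * b) v.
Proof. by []. Qed.
Let unit_scale1 : left_id 1 unit_scale. Proof. by case. Qed.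
Let unit_scaleDr : right_distributive unit_scale +%R. Proof. by []. Qed.
Let unit_scaleDl v : {morph unit_scale^~ v : a b / a + b}. Proof. by []. Qed.

HB.instance Definition _ := GRing.Zmodule_isLmodule.Build k unit
  unit_scaleA unit_scale1 unit_scaleDr unit_scaleDl.

End UnitModule.

Section Submodule.
Variables (k : comPzRingType) (V : lmodType k).

Record submod := Submod {
  submod_set :> set V;
  submod_setP : submod_closed (mem submod_set)
}.

Variable S : submod.

Definition in_submod : {pred V} := mem (submod_set S).

HB.instance Definition _ := GRing.isSubmodClosed.Build k V in_submod
  (GRing.submod_closed_semi (submod_setP S)).

Lemma in_submodE x : (x \in in_submod) = `[< submod_set S x >].
Proof. by []. Qed.

Lemma in_submodP x : x \in in_submod <-> submod_set S x.
Proof. by rewrite in_submodE; split=> /asboolP. Qed.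

Record submod_type := SubmodType {
  submod_val : V;
  _ : submod_val \in in_submod
}.

HB.instance Definition _ := [isSub for submod_val].
HB.instance Definition _ := [Choice of submod_type by <:].
HB.instance Definition _ := [SubChoice_isSubLmodule of submod_type by <:].

Definition quotmod : Type := {ideal_quot in_submod}.

HB.instance Definition _ := GRing.Zmodule.on quotmod.

Definition qpi (x : V) : quotmod := (\pi_{ideal_quot in_submod} x)%qT.
Definition qrepr (x : quotmod) : V := repr (x : {ideal_quot in_submod}).

Lemma qreprK x : qpi (qrepr x) = x. Proof. exact: reprK. Qed.

Lemma qpi_eq x y : qpi x = qpi y <-> submod_set S (x - y).
Proof.
rewrite -in_submodP Quotient.idealrBE.
by split=> [xy|/eqP//]; apply/eqP; exact: xy.
Qed.

Let qD : {morph qpi : x y / x + y}.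
Proof. by move=> x y; rewrite /qpi raddfD. Qed.

Definition qscale a x := qpi (a *: qrepr x).

Let qscaleE a x : qscale a (qpi x) = qpi (a *: x).
Proof.
apply/qpi_eq/in_submodP; rewrite -scalerBr rpredZ//.
by apply/in_submodP/qpi_eq; rewrite qreprK.
Qed.

Let qscaleA a b v : qscale a (qscale b v) = qscale (a * b) v.
Proof. by rewrite -(qreprK v) !qscaleE scalerA. Qed.
Let qscale1 : left_id 1 qscale.
Proof. by move=> v; rewrite -(qreprK v) !qscaleE scale1r. Qed.
Let qscaleDr : right_distributive qscale +%R.
Proof.
by move=> a u v; rewrite -(qreprK u) -(qreprK v) -qD !qscaleE scalerDr qD.
Qed.
Let qscaleDl v : {morph qscale^~ v : a b / a + b}.
Proof. by move=> a b; rewrite -(qreprK v) !qscaleE scalerDl qD. Qed.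

HB.instance Definition _ := GRing.Zmodule_isLmodule.Build k quotmod
  qscaleA qscale1 qscaleDr qscaleDl.

Lemma qpi_linear : linear qpi.
Proof. by move=> a u v; rewrite qD -qscaleE. Qed.

HB.instance Definition _ := GRing.isLinear.Build k V quotmod *:%R qpi qpi_linear.

End Submodule.

Inductive side := Lft | Rgt.

Section Dialgebras.
Variable k : comPzRingType.

Record bimap (A B C : lmodType k) := Bimap {
  bop :> A -> B -> C;
  bopP : bilinear_op bop
}.

Section BimapTheory.
Variables (A B C : lmodType k) (f : bimap A B C).

Lemma bopPl a u v w : f (a *: u + v) w = a *: f u w + f v w.
Proof. exact: (bopP f).1. Qed.
Lemma bopPr a u v w : f w (a *: u + v) = a *: f w u + f w v.
Proof. exact: (bopP f).2. Qed.
Lemma bopDl u v w : f (u + v) w = f u w + f v w.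
Proof. by rewrite -[u]scale1r bopPl !scale1r. Qed.
Lemma bopDr u v w : f w (u + v) = f w u + f w v.
Proof. by rewrite -[u]scale1r bopPr !scale1r. Qed.
Lemma bop0l w : f 0 w = 0.
Proof. by apply: (@addrI _ (f 0 w)); rewrite -bopDl !addr0. Qed.
Lemma bop0r w : f w 0 = 0.
Proof. by apply: (@addrI _ (f w 0)); rewrite -bopDr !addr0. Qed.
Lemma bopZl a u w : f (a *: u) w = a *: f u w.
Proof. by rewrite -[a *: u]addr0 bopPl bop0l addr0. Qed.
Lemma bopZr a u w : f w (a *: u) = a *: f w u.
Proof. by rewrite -[a *: u]addr0 bopPr bop0r addr0. Qed.
Lemma bopBl u v w : f (u - v) w = f u w - f v w.
Proof. by rewrite bopDl -scaleN1r bopZl scaleN1r. Qed.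
Lemma bopBr u v w : f w (u - v) = f w u - f w v.
Proof. by rewrite bopDr -scaleN1r bopZr scaleN1r. Qed.

End BimapTheory.

(* A pair of bilinear products, [p Lft] being the product written [⊣] and
   [p Rgt] the one written [⊢]. *)
Definition diprod (A B C : lmodType k) := side -> bimap A B C.

Local Notation "x ⊣[ p ] y" := (bop (p Lft) x y)
  (at level 40, left associativity, format "x  ⊣[ p ]  y").
Local Notation "x ⊢[ p ] y" := (bop (p Rgt) x y)
  (at level 40, left associativity, format "x  ⊢[ p ]  y").

(* The dialgebra identities for x in A, y in B, z in C, where the products of
   x and y lie in AB, those of y and z in BC, and the triple products in E.
   Varying the modules yields both the axioms of a dialgebra and those of an
   action. *)
Definition dias_identities (A B C AB BC E : lmodType k)
    (ab : diprod A B AB) (ab_c : diprod AB C E)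
    (bc : diprod B C BC) (a_bc : diprod A BC E) :=
  forall x y z,
  [/\ (x ⊣[ab] y) ⊣[ab_c] z = x ⊣[a_bc] (y ⊢[bc] z),
      (x ⊣[ab] y) ⊣[ab_c] z = x ⊣[a_bc] (y ⊣[bc] z),
      (x ⊢[ab] y) ⊣[ab_c] z = x ⊢[a_bc] (y ⊣[bc] z),
      (x ⊣[ab] y) ⊢[ab_c] z = x ⊢[a_bc] (y ⊢[bc] z)
    & (x ⊢[ab] y) ⊢[ab_c] z = x ⊢[a_bc] (y ⊢[bc] z)].

Record dialgebra := Dialgebra {
  dcar :> lmodType k;
  dmul : diprod dcar dcar dcar;
  dmulP : dias_identities dmul dmul dmul dmul
}.
Arguments dmul {d} s.

Local Notation "x ⊣ y" := (bop (dmul Lft) x y)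
  (at level 40, left associativity).
Local Notation "x ⊢ y" := (bop (dmul Rgt) x y)
  (at level 40, left associativity).

Record dhom (D E : dialgebra) := DHom {
  dhom_lin :> {linear D -> E};
  dhomM : forall s x y,
    dhom_lin (dmul s x y) = dmul s (dhom_lin x) (dhom_lin y)
}.

Lemma dhom_eq D E (f g : dhom D E) : f =1 g -> f = g.
Proof.
case: f g => [f fM] [g gM] /= /linear_eq fg; subst g.
by rewrite (Prop_irrelevance fM gM).
Qed.

Section DhomCategory.
Variables B C D E : dialgebra.

Lemma did_subproof s (x y : D) : idfun (dmul s x y) = dmul s (idfun x) (idfun y).
Proof. by []. Qed.

Definition did : dhom D D :=
  @DHom D D (idfun : {linear D -> D}) did_subproof.

Lemma dcomp_subproof (g : dhom D E) (f : dhom C D) s (x y : C) :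
  (g \o f) (dmul s x y) = dmul s ((g \o f) x) ((g \o f) y).
Proof. by rewrite /= !dhomM. Qed.

Definition dcomp (g : dhom D E) (f : dhom C D) : dhom C E :=
  @DHom C E (g \o f : {linear C -> E}) (dcomp_subproof g f).

End DhomCategory.
Arguments did : clear implicits.

Lemma dcompA B C D E (h : dhom D E) (g : dhom C D) (f : dhom B C) :
  dcomp h (dcomp g f) = dcomp (dcomp h g) f.
Proof. exact: dhom_eq. Qed.

Lemma dcomp1l C D (f : dhom C D) : dcomp (did D) f = f.
Proof. exact: dhom_eq. Qed.

Lemma dcomp1r C D (f : dhom C D) : dcomp f (did C) = f.
Proof. exact: dhom_eq. Qed.

Definition Dias : category := Category dcompA dcomp1l dcomp1r.

Definition is_ideal (D : dialgebra) (I : set D) :=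
  submod_closed (mem I) /\
  forall x y : D, I x -> [/\ I (x ⊣ y), I (x ⊢ y), I (y ⊣ x) & I (y ⊢ x)].

Record ideal (D : dialgebra) := Ideal {
  ideal_set :> set D;
  ideal_setP : is_ideal ideal_set
}.

Lemma ideal_mull (D : dialgebra) (I : ideal D) s (x y : D) :
  ideal_set I x -> ideal_set I (dmul s x y).
Proof. by move=> Ix; case: ((ideal_setP I).2 x y Ix); case: s. Qed.

Lemma ideal_mulr (D : dialgebra) (I : ideal D) s (x y : D) :
  ideal_set I x -> ideal_set I (dmul s y x).
Proof. by move=> Ix; case: ((ideal_setP I).2 x y Ix); case: s. Qed.

Definition submod_of_ideal (D : dialgebra) (I : ideal D) : submod D :=
  Submod (ideal_setP I).1.

Section QuotientDialgebra.
Variables (D : dialgebra) (I : ideal D).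

Local Notation Q := (quotmod (submod_of_ideal I)).
Local Notation pi := (@qpi _ _ (submod_of_ideal I)).

Definition qmul s (x y : Q) : Q := pi (dmul s (qrepr x) (qrepr y)).

Lemma qmulE s x y : qmul s (pi x) (pi y) = pi (dmul s x y).
Proof.
have qreprI z : ideal_set I (qrepr (pi z) - z).
  by apply/(@qpi_eq _ _ (submod_of_ideal I)); rewrite qreprK.
rewrite /qmul; set x' := qrepr (pi x); set y' := qrepr (pi y).
transitivity (pi (dmul s x y')); apply/qpi_eq; rewrite /= -(bopBl, bopBr).
- exact/ideal_mull/qreprI.
- exact/ideal_mulr/qreprI.
Qed.

Lemma qmul_bilinear s : bilinear_op (qmul s).
Proof.
split=> [w a u v|w a u v]; rewrite -(qreprK w) -(qreprK u) -(qreprK v);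
  rewrite -linearP !qmulE -linearP; congr qpi; by rewrite (bopPl, bopPr).
Qed.

Definition qmul_bimap s := Bimap (qmul_bilinear s).

Lemma qmulP : dias_identities qmul_bimap qmul_bimap qmul_bimap qmul_bimap.
Proof.
move=> x y z; rewrite -(qreprK x) -(qreprK y) -(qreprK z) /= !qmulE.
by case: (dmulP (qrepr x) (qrepr y) (qrepr z)) => e1 e2 e3 e4 e5;
  split; congr qpi.
Qed.

Definition quot_dias : dialgebra := @Dialgebra Q qmul_bimap qmulP.

Definition quot_pi : dhom D quot_dias :=
  @DHom D quot_dias (pi : {linear D -> Q}) (fun s x y => esym (qmulE s x y)).

Lemma quot_pi_surj (q : quot_dias) : exists x, quot_pi x = q.
Proof. by exists (qrepr q); rewrite /= qreprK. Qed.

Lemma quot_pi0 x : quot_pi x = 0 <-> ideal_set I x.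
Proof.
by rewrite -(linear0 quot_pi); split=> [/qpi_eq|Ix]; rewrite ?subr0 //;
  apply/qpi_eq; rewrite subr0.
Qed.

Section Lift.
Variables (E : dialgebra) (f : dhom D E) (fI : forall x, ideal_set I x -> f x = 0).

Definition quot_lift_fun (q : Q) : E := f (qrepr q).

Lemma quot_lift_funE x : quot_lift_fun (pi x) = f x.
Proof.
apply/eqP; rewrite -subr_eq0 -linearB; apply/eqP/fI.
by apply/(@qpi_eq _ _ (submod_of_ideal I)); rewrite qreprK.
Qed.

Lemma quot_lift_linear : linear quot_lift_fun.
Proof.
move=> a u v; rewrite -(qreprK u) -(qreprK v) -linearP !quot_lift_funE.
exact: linearP.
Qed.

HB.instance Definition _ :=
  GRing.isLinear.Build k Q E *:%R quot_lift_fun quot_lift_linear.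

Lemma quot_liftM s (x y : quot_dias) :
  quot_lift_fun (dmul s x y) = dmul s (quot_lift_fun x) (quot_lift_fun y).
Proof.
exact: etrans (quot_lift_funE (dmul s (qrepr x) (qrepr y))) (dhomM f s _ _).
Qed.

Definition quot_lift : dhom quot_dias E :=
  @DHom quot_dias E (quot_lift_fun : {linear Q -> E}) quot_liftM.

Lemma quot_liftE x : quot_lift (quot_pi x) = f x.
Proof. exact: quot_lift_funE. Qed.

End Lift.

Lemma quot_hom_eq (E : dialgebra) (f g : dhom quot_dias E) :
  (forall x, f (quot_pi x) = g (quot_pi x)) -> f = g.
Proof.
by move=> fg; apply: dhom_eq => q; have [x <-] := quot_pi_surj q.
Qed.

End QuotientDialgebra.

Definition gen_ideal_set (D : dialgebra) (S : set D) : set D :=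
  smallest (@is_ideal D) S.

Lemma gen_ideal_is_ideal (D : dialgebra) (S : set D) : is_ideal (gen_ideal_set S).
Proof.
split=> [|x y Ix].
  apply/submod_closedE; split=> [A [[/submod_closedE[]]]//|a u v Iu Iv A AP].
  have [[/submod_closedE[_ Ac] _] _] := AP.
  by apply: Ac; [exact: Iu|exact: Iv].
by split=> A AP; have [[_ Am] _] := AP; case: (Am x y (Ix A AP)).
Qed.

Definition gen_ideal (D : dialgebra) (S : set D) : ideal D :=
  Ideal (gen_ideal_is_ideal S).

Lemma gen_ideal_sub (D : dialgebra) (S : set D) : S `<=` gen_ideal S.
Proof. exact: sub_gen_smallest. Qed.

Definition dker (D E : dialgebra) (f : dhom D E) : set D :=
  [set x | f x = 0].

Lemma dker_ideal D E (f : dhom D E) : is_ideal (dker f).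
Proof.
split; last by move=> x y /= fx; split; rewrite /dker/= dhomM fx ?bop0l ?bop0r.
apply/submod_closedE; rewrite /dker/=; split=> [|a u v fu fv]; first exact: linear0.
by rewrite linearP fu fv scaler0 addr0.
Qed.

Lemma gen_ideal_ker D E (f : dhom D E) (S : set D) :
  (forall x, S x -> f x = 0) -> forall x, gen_ideal_set S x -> f x = 0.
Proof.
by move=> fS; apply: (smallest_sub (X := dker f)) => //; exact: dker_ideal.
Qed.

Definition dker_submod (D E : dialgebra) (f : dhom D E) : submod D :=
  Submod (dker_ideal f).1.

Section KernelDialgebra.
Variables (D E : dialgebra) (f : dhom D E).

Local Notation K := (submod_type (dker_submod f)).

Lemma kerP (x : K) : f (val x) = 0.
Proof. by case: x => x /= /in_submodP. Qed.

Lemma ker_mem x : f x = 0 -> x \in in_submod (dker_submod f).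
Proof. by move=> fx; apply/in_submodP. Qed.

Definition ker_elt x (fx : f x = 0) : K := SubmodType (ker_mem fx).

Lemma ker_mull s (x : D) (y : D) : f x = 0 -> f (dmul s x y) = 0.
Proof. by move=> fx; rewrite dhomM fx bop0l. Qed.

Lemma ker_mulr s (x : D) (y : D) : f y = 0 -> f (dmul s x y) = 0.
Proof. by move=> fy; rewrite dhomM fy bop0r. Qed.

Definition ker_mul s (x y : K) : K := ker_elt (ker_mull s (val y) (kerP x)).

Lemma ker_mul_bilinear s : bilinear_op (ker_mul s).
Proof. by split=> w a u v; apply: val_inj; rewrite /= (bopPl, bopPr). Qed.

Definition ker_bimap s := Bimap (ker_mul_bilinear s).

Lemma ker_mulP : dias_identities ker_bimap ker_bimap ker_bimap ker_bimap.
Proof.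
by move=> x y z; case: (dmulP (val x) (val y) (val z)) => *;
  split; apply: val_inj.
Qed.

Definition ker_dias : dialgebra := @Dialgebra K ker_bimap ker_mulP.

Definition ker_incl : dhom ker_dias D :=
  @DHom ker_dias D (val : {linear K -> D}) (fun s x y => erefl).

End KernelDialgebra.

(* The free dialgebra on a module, built syntactically; [free_lift],
   [free_liftE] and [free_hom_eq] below give its universal property. *)
Section FreeDialgebra.
Variable V : lmodType k.

Inductive dterm :=
| TGen of V
| TZero
| TOpp of dterm
| TAdd of dterm & dterm
| TScale of k & dterm
| TMul of side & dterm & dterm.

(* The least congruence for which the quotient is a dialgebra and [TGen] is
   linear. *)
Inductive dterm_eq : dterm -> dterm -> Prop :=
| E_refl t : dterm_eq t t
| E_sym t u : dterm_eq t u -> dterm_eq u t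
| E_trans t u v : dterm_eq t u -> dterm_eq u v -> dterm_eq t v
| E_opp t t' : dterm_eq t t' -> dterm_eq (TOpp t) (TOpp t')
| E_add t t' u u' : dterm_eq t t' -> dterm_eq u u' ->
    dterm_eq (TAdd t u) (TAdd t' u')
| E_scale a t t' : dterm_eq t t' -> dterm_eq (TScale a t) (TScale a t')
| E_mul s t t' u u' : dterm_eq t t' -> dterm_eq u u' ->
    dterm_eq (TMul s t u) (TMul s t' u')
| E_addA t u v : dterm_eq (TAdd t (TAdd u v)) (TAdd (TAdd t u) v)
| E_addC t u : dterm_eq (TAdd t u) (TAdd u t)
| E_add0 t : dterm_eq (TAdd TZero t) t
| E_addN t : dterm_eq (TAdd (TOpp t) t) TZero
| E_scaleA a b t : dterm_eq (TScale a (TScale b t)) (TScale (a * b) t)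
| E_scale1 t : dterm_eq (TScale 1 t) t
| E_scaleDr a t u :
    dterm_eq (TScale a (TAdd t u)) (TAdd (TScale a t) (TScale a u))
| E_scaleDl a b t :
    dterm_eq (TScale (a + b) t) (TAdd (TScale a t) (TScale b t))
| E_gen a x y :
    dterm_eq (TGen (a *: x + y)) (TAdd (TScale a (TGen x)) (TGen y))
| E_mull s a t u v : dterm_eq (TMul s (TAdd (TScale a t) u) v)
    (TAdd (TScale a (TMul s t v)) (TMul s u v))
| E_mulr s a t u v : dterm_eq (TMul s v (TAdd (TScale a t) u))
    (TAdd (TScale a (TMul s v t)) (TMul s v u))
| E_dias1 t u v :
    dterm_eq (TMul Lft (TMul Lft t u) v) (TMul Lft t (TMul Rgt u v))
| E_dias2 t u v :
    dterm_eq (TMul Lft (TMul Lft t u) v) (TMul Lft t (TMul Lft u v))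
| E_dias3 t u v :
    dterm_eq (TMul Lft (TMul Rgt t u) v) (TMul Rgt t (TMul Lft u v))
| E_dias4 t u v :
    dterm_eq (TMul Rgt (TMul Lft t u) v) (TMul Rgt t (TMul Rgt u v))
| E_dias5 t u v :
    dterm_eq (TMul Rgt (TMul Rgt t u) v) (TMul Rgt t (TMul Rgt u v)).

HB.instance Definition _ := gen_eqMixin dterm.
HB.instance Definition _ := gen_choiceMixin dterm.

Definition dterm_eqb (t u : dterm) : bool := `[< dterm_eq t u >].

Lemma dterm_eqb_equiv : equiv_class_of dterm_eqb.
Proof.
split=> [t|t u|u t v].
- exact/asboolP/E_refl.
- by apply/asboolP/asboolP; exact: E_sym.
- by move=> /asboolP tu /asboolP uv; apply/asboolP; exact: E_trans uv.
Qed.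

Canonical dterm_eqb_equivRel := EquivRelPack dterm_eqb_equiv.
Canonical dterm_eqb_encModRel := defaultEncModRel dterm_eqb.

Definition free_car : Type := {eq_quot dterm_eqb}%qT.

HB.instance Definition _ := Choice.on free_car.

Definition fpi (t : dterm) : free_car := (\pi_{eq_quot dterm_eqb} t)%qT.
Definition frepr (x : free_car) : dterm := repr (x : {eq_quot dterm_eqb}%qT).

Lemma freprK x : fpi (frepr x) = x. Proof. exact: reprK. Qed.

Lemma fpi_eq t u : fpi t = fpi u <-> dterm_eq t u.
Proof.
have e : (t == u %[mod {eq_quot dterm_eqb}])%qT = dterm_eqb t u by rewrite piE.
split=> [tu|tu]; last by apply/eqP; rewrite e; exact/asboolP.
by apply/asboolP; rewrite -[asbool _]e; apply/eqP.
Qed.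

Lemma fpiK t : dterm_eq (frepr (fpi t)) t.
Proof. by apply/fpi_eq; rewrite freprK. Qed.

Definition fzero := fpi TZero.
Definition fopp x := fpi (TOpp (frepr x)).
Definition fadd x y := fpi (TAdd (frepr x) (frepr y)).
Definition fscale a x := fpi (TScale a (frepr x)).
Definition fmul s x y := fpi (TMul s (frepr x) (frepr y)).

Lemma foppE t : fopp (fpi t) = fpi (TOpp t).
Proof. exact/fpi_eq/E_opp/fpiK. Qed.
Lemma faddE t u : fadd (fpi t) (fpi u) = fpi (TAdd t u).
Proof. by apply/fpi_eq/E_add; exact: fpiK. Qed.
Lemma fscaleE a t : fscale a (fpi t) = fpi (TScale a t).
Proof. exact/fpi_eq/E_scale/fpiK. Qed.
Lemma fmulE s t u : fmul s (fpi t) (fpi u) = fpi (TMul s t u).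
Proof. by apply/fpi_eq/E_mul; exact: fpiK. Qed.

Definition fE := (foppE, faddE, fscaleE, fmulE).

Lemma faddA : associative fadd.
Proof.
move=> x y z; rewrite -(freprK x) -(freprK y) -(freprK z) !fE.
exact/fpi_eq/E_addA.
Qed.
Lemma faddC : commutative fadd.
Proof.
by move=> x y; rewrite -(freprK x) -(freprK y) !fE; exact/fpi_eq/E_addC.
Qed.
Lemma fadd0 : left_id fzero fadd.
Proof. by move=> x; rewrite -(freprK x) !fE; exact/fpi_eq/E_add0. Qed.
Lemma faddN : left_inverse fzero fopp fadd.
Proof. by move=> x; rewrite -(freprK x) !fE; exact/fpi_eq/E_addN. Qed.

HB.instance Definition _ := GRing.isZmodule.Build free_car
  faddA faddC fadd0 faddN.

Lemma fscaleA a b x : fscale a (fscale b x) = fscale (a * b) x.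
Proof. by rewrite -(freprK x) !fE; exact/fpi_eq/E_scaleA. Qed.
Lemma fscale1 : left_id 1 fscale.
Proof. by move=> x; rewrite -(freprK x) !fE; exact/fpi_eq/E_scale1. Qed.
Lemma fscaleDr : right_distributive fscale +%R.
Proof.
move=> a x y; rewrite -(freprK x) -(freprK y).
by rewrite [fpi _ + _]faddE !fscaleE [RHS]faddE; exact/fpi_eq/E_scaleDr.
Qed.
Lemma fscaleDl x : {morph fscale^~ x : a b / a + b}.
Proof.
move=> a b; rewrite -(freprK x) !fscaleE.
by rewrite [RHS]faddE; exact/fpi_eq/E_scaleDl.
Qed.

HB.instance Definition _ := GRing.Zmodule_isLmodule.Build k free_car
  fscaleA fscale1 fscaleDr fscaleDl.

Lemma fpiP a t u : fpi (TAdd (TScale a t) u) = a *: fpi t + fpi u.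
Proof. by rewrite -faddE -fscaleE. Qed.

Lemma fmul_bilinear s : bilinear_op (fmul s).
Proof.
split=> w a x y; rewrite -(freprK w) -(freprK x) -(freprK y) -fpiP !fmulE -fpiP.
- exact/fpi_eq/E_mull.
- exact/fpi_eq/E_mulr.
Qed.

Definition fmul_bimap s := Bimap (fmul_bilinear s).

Lemma fmulP : dias_identities fmul_bimap fmul_bimap fmul_bimap fmul_bimap.
Proof.
move=> x y z; rewrite -(freprK x) -(freprK y) -(freprK z) /= !fmulE.
by split; apply/fpi_eq; constructor.
Qed.

Definition free_dias : dialgebra := @Dialgebra free_car fmul_bimap fmulP.

Definition free_gen (x : V) : free_dias := fpi (TGen x).

Lemma free_gen_linear : linear free_gen.
Proof. by move=> a x y; rewrite -[RHS]fpiP; exact/fpi_eq/E_gen. Qed.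

HB.instance Definition _ :=
  GRing.isLinear.Build k V free_dias *:%R free_gen free_gen_linear.

Section Lift.
Variables (D : dialgebra) (f : {linear V -> D}).

Fixpoint dterm_eval (t : dterm) : D :=
  match t with
  | TGen x => f x
  | TZero => 0
  | TOpp t => - dterm_eval t
  | TAdd t u => dterm_eval t + dterm_eval u
  | TScale a t => a *: dterm_eval t
  | TMul s t u => dmul s (dterm_eval t) (dterm_eval u)
  end.

Lemma dterm_eval_eq t u : dterm_eq t u -> dterm_eval t = dterm_eval u.
Proof.
elim=> {t u} //=.
- by move=> t u v _ -> _ ->.
- by move=> t u _ ->.
- by move=> t t' u u' _ -> _ ->.
- by move=> a t t' _ ->.
- by move=> s t t' u u' _ -> _ ->.
- by move=> *; rewrite addrA.
- by move=> *; rewrite addrC.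
- by move=> *; rewrite add0r.
- by move=> *; rewrite addNr.
- by move=> *; rewrite scalerA.
- by move=> *; rewrite scale1r.
- by move=> *; rewrite scalerDr.
- by move=> *; rewrite scalerDl.
- by move=> *; rewrite linearP.
- by move=> *; rewrite bopPl.
- by move=> *; rewrite bopPr.
all: by move=> t u v; case: (dmulP (dterm_eval t) (dterm_eval u) (dterm_eval v)).
Qed.

Definition free_lift_fun (x : free_car) : D := dterm_eval (frepr x).

Lemma free_lift_funE t : free_lift_fun (fpi t) = dterm_eval t.
Proof. exact/dterm_eval_eq/fpiK. Qed.

Lemma free_lift_linear : linear free_lift_fun.
Proof.
by move=> a x y; rewrite -(freprK x) -(freprK y) -fpiP !free_lift_funE.
Qed.

HB.instance Definition _ :=
  GRing.isLinear.Build k free_car D *:%R free_lift_fun free_lift_linear.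

Lemma free_liftM s (x y : free_dias) :
  free_lift_fun (dmul s x y) = dmul s (free_lift_fun x) (free_lift_fun y).
Proof.
exact: (free_lift_funE (TMul s (frepr x) (frepr y))).
Qed.

Definition free_lift : dhom free_dias D :=
  @DHom free_dias D (free_lift_fun : {linear free_car -> D}) free_liftM.

Lemma free_liftE x : free_lift (free_gen x) = f x.
Proof. exact: free_lift_funE. Qed.

End Lift.

Lemma free_hom_eq (D : dialgebra) (f g : dhom free_dias D) :
  (forall x, f (free_gen x) = g (free_gen x)) -> f = g.
Proof.
move=> fg; apply: dhom_eq => x; rewrite -(freprK x).
elim: (frepr x) => [v||t IH|t IHt u IHu|a t IH|s t IHt u IHu].
- exact: fg.
- by have -> : fpi TZero = 0 :> free_dias; [|rewrite !linear0].
- have -> : fpi (TOpp t) = - (fpi t : free_dias) by rewrite -foppE.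
  by rewrite !linearN IH.
- have -> : fpi (TAdd t u) = (fpi t : free_dias) + fpi u by rewrite -faddE.
  by rewrite !linearD IHt IHu.
- have -> : fpi (TScale a t) = a *: (fpi t : free_dias) by rewrite -fscaleE.
  by rewrite !linearZ IH.
- have -> : fpi (TMul s t u) = dmul s (fpi t : free_dias) (fpi u).
    by rewrite -fmulE.
  by rewrite !dhomM IHt IHu.
Qed.

End FreeDialgebra.

(* The six identities run over the ways of placing one or two of the variables
   x, y, z in L and the others in D; each bundles five equalities. *)
Record dias_action (D L : dialgebra) := DiasAction {
  dactl : diprod D L L;
  dactr : diprod L D L;
  dact_DLL : dias_identities dactl dmul dmul dactl;
  dact_LDL : dias_identities dactr dmul dactl dmul;
  dact_LLD : dias_identities dmul dactr dactr dmul;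
  dact_LDD : dias_identities dactr dactr dmul dactr;
  dact_DLD : dias_identities dactl dactr dactr dactl;
  dact_DDL : dias_identities dmul dactl dactl dactl
}.

Record xdias := XDiasObj {
  xd_top : dialgebra;
  xd_base : dialgebra;
  xd_map : dhom xd_top xd_base;
  xd_act : dias_action xd_base xd_top;
  xd_equivl : forall s x l, xd_map (dactl xd_act s x l) = dmul s x (xd_map l);
  xd_equivr : forall s l x, xd_map (dactr xd_act s l x) = dmul s (xd_map l) x;
  xd_peifferl : forall s l l', dactl xd_act s (xd_map l) l' = dmul s l l';
  xd_peifferr : forall s l l', dactr xd_act s l (xd_map l') = dmul s l l'
}.

Record xdhom (M N : xdias) := XDHom {
  xdh_top : dhom (xd_top M) (xd_top N);
  xdh_base : dhom (xd_base M) (xd_base N);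
  xdh_comm : forall l, xd_map N (xdh_top l) = xdh_base (xd_map M l);
  xdh_actl : forall s x l,
    xdh_top (dactl (xd_act M) s x l) =
    dactl (xd_act N) s (xdh_base x) (xdh_top l);
  xdh_actr : forall s l x,
    xdh_top (dactr (xd_act M) s l x) =
    dactr (xd_act N) s (xdh_top l) (xdh_base x)
}.

Lemma xdhom_eq M N (f g : xdhom M N) :
  xdh_top f =1 xdh_top g -> xdh_base f =1 xdh_base g -> f = g.
Proof.
case: f g => [f1 f2 a b c] [g1 g2 a' b' c'] /= /dhom_eq e1 /dhom_eq e2; subst.
by congr XDHom; exact: Prop_irrelevance.
Qed.

Definition xdid (M : xdias) : xdhom M M :=
  @XDHom M M (did _) (did _) (fun=> erefl) (fun _ _ _ => erefl)
    (fun _ _ _ => erefl).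

Section XdComp.
Variables (M N P : xdias) (g : xdhom N P) (f : xdhom M N).

Let top := dcomp (xdh_top g) (xdh_top f).
Let base := dcomp (xdh_base g) (xdh_base f).

Lemma xdcomp_comm l : xd_map P (top l) = base (xd_map M l).
Proof. by rewrite /= !xdh_comm. Qed.
Lemma xdcomp_actl s x l :
  top (dactl (xd_act M) s x l) = dactl (xd_act P) s (base x) (top l).
Proof. by rewrite /= !xdh_actl. Qed.
Lemma xdcomp_actr s l x :
  top (dactr (xd_act M) s l x) = dactr (xd_act P) s (top l) (base x).
Proof. by rewrite /= !xdh_actr. Qed.

Definition xdcomp : xdhom M P := XDHom xdcomp_comm xdcomp_actl xdcomp_actr.

End XdComp.

Lemma xdcompA M N P Q (h : xdhom P Q) (g : xdhom N P) (f : xdhom M N) :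
  xdcomp h (xdcomp g f) = xdcomp (xdcomp h g) f.
Proof. exact: xdhom_eq. Qed.

Lemma xdcomp1l M N (f : xdhom M N) : xdcomp (xdid N) f = f.
Proof. exact: xdhom_eq. Qed.

Lemma xdcomp1r M N (f : xdhom M N) : xdcomp f (xdid M) = f.
Proof. exact: xdhom_eq. Qed.

Definition XDias : category := Category xdcompA xdcomp1l xdcomp1r.

End Dialgebras.

Arguments dmul {k d} s.

Section Leibniz.
Variable k : comPzRingType.

(* [x,[y,z]] = [[x,y],z] - [[x,z],y] for x in A, y in B, z in C. *)
Definition leib_identity (A B C BC AB AC E : lmodType k)
    (bc : bimap B C BC) (a_bc : bimap A BC E)
    (ab : bimap A B AB) (ab_c : bimap AB C E)
    (ac : bimap A C AC) (ac_b : bimap AC B E) :=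
  forall x y z, a_bc x (bc y z) = ab_c (ab x y) z - ac_b (ac x z) y.

Record leibniz := Leibniz {
  lcar :> lmodType k;
  lbr : bimap lcar lcar lcar;
  lbrP : leib_identity lbr lbr lbr lbr lbr lbr
}.
Arguments lbr {l}.

Record lhom (g h : leibniz) := LHom {
  lhom_lin :> {linear g -> h};
  lhomM : forall x y, lhom_lin (lbr x y) = lbr (lhom_lin x) (lhom_lin y)
}.

Lemma lhom_eq g h (f f' : lhom g h) : f =1 f' -> f = f'.
Proof.
case: f f' => [f fM] [f' f'M] /= /linear_eq ff'; subst f'.
by rewrite (Prop_irrelevance fM f'M).
Qed.

Section LhomCategory.
Variables f g h : leibniz.

Lemma lid_subproof (x y : g) : idfun (lbr x y) = lbr (idfun x) (idfun y).
Proof. by []. Qed.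

Definition lid : lhom g g := @LHom g g (idfun : {linear g -> g}) lid_subproof.

Lemma lcomp_subproof (b : lhom g h) (a : lhom f g) (x y : f) :
  (b \o a) (lbr x y) = lbr ((b \o a) x) ((b \o a) y).
Proof. by rewrite /= !lhomM. Qed.

Definition lcomp (b : lhom g h) (a : lhom f g) : lhom f h :=
  @LHom f h (b \o a : {linear f -> h}) (lcomp_subproof b a).

End LhomCategory.
Arguments lid : clear implicits.

Lemma lcompA e f g h (c : lhom g h) (b : lhom f g) (a : lhom e f) :
  lcomp c (lcomp b a) = lcomp (lcomp c b) a.
Proof. exact: lhom_eq. Qed.

Lemma lcomp1l g h (f : lhom g h) : lcomp (lid h) f = f.
Proof. exact: lhom_eq. Qed.

Lemma lcomp1r g h (f : lhom g h) : lcomp f (lid g) = f.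
Proof. exact: lhom_eq. Qed.

Definition Lb : category := Category lcompA lcomp1l lcomp1r.

(* As for dialgebras, the six identities place one or two of the variables
   x, y, z in q and the others in g. *)
Record leib_action (g q : leibniz) := LeibAction {
  lactl : bimap g q q;
  lactr : bimap q g q;
  lact_gqq : leib_identity lbr lactl lactl lbr lactl lbr;
  lact_qgq : leib_identity lactl lbr lactr lbr lbr lactr;
  lact_qqg : leib_identity lactr lbr lbr lactr lactr lbr;
  lact_qgg : leib_identity lbr lactr lactr lactr lactr lactr;
  lact_gqg : leib_identity lactr lactl lactl lactr lbr lactl;
  lact_ggq : leib_identity lactl lactl lbr lactl lactl lactr
}.

Section SemiDirect.
Variables (g q : leibniz) (act : leib_action g q).

Definition sd_br (u v : q * g) : q * g :=
  (lbr u.1 v.1 + lactr act u.1 v.2 + lactl act u.2 v.1, lbr u.2 v.2).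

Lemma sd_br_bilinear : bilinear_op sd_br.
Proof.
split=> [[w1 w2] a [u1 u2] [v1 v2]|[w1 w2] a [u1 u2] [v1 v2]];
  rewrite /sd_br /= !(bopPl, bopPr); congr pair;
  by rewrite /= !scalerDr; rewrite !addrA; rewrite [LHS](ACl (1*3*5*2*4*6)).
Qed.

Definition sd_bimap := Bimap sd_br_bilinear.

Let sum_rearrange (V : zmodType) (p1 p2 p3 p4 p5 p6 p7 : V)
    (n1 n2 n3 n4 n5 n6 n7 : V) :
  ((p1 - n1) + (p2 - n2) + (p3 - n3)) + (p4 - n4)
    + ((p5 - n5) + (p6 - n6) + (p7 - n7)) =
  ((p1 + p3 + p5) + (p2 + p4 + p6) + p7)
    - ((n1 + n2 + n5) + (n3 + n4 + n7) + n6).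
Proof.
rewrite !opprD !addrA.
by rewrite [RHS](ACl (1*8*4*9*2*11*5*12*3*10*6*14*7*13)).
Qed.

Lemma sd_brP : leib_identity
  sd_bimap sd_bimap sd_bimap sd_bimap sd_bimap sd_bimap.
Proof.
move=> [a x] [b y] [c z]; rewrite /= /sd_br /=; congr pair; last exact: lbrP.
rewrite !(bopDl, bopDr) lbrP lact_gqq lact_qgq lact_qqg lact_qgg lact_gqg.
by rewrite lact_ggq; exact: sum_rearrange.
Qed.

Definition semidirect : leibniz := @Leibniz (q * g)%type sd_bimap sd_brP.

End SemiDirect.

Record xleib := XLeibObj {
  xl_top : leibniz;
  xl_base : leibniz;
  xl_map : lhom xl_top xl_base;
  xl_act : leib_action xl_base xl_top;
  xl_equivl : forall g q, xl_map (lactl xl_act g q) = lbr g (xl_map q);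
  xl_equivr : forall q g, xl_map (lactr xl_act q g) = lbr (xl_map q) g;
  xl_peifferl : forall q q', lactl xl_act (xl_map q) q' = lbr q q';
  xl_peifferr : forall q q', lactr xl_act q (xl_map q') = lbr q q'
}.

Record xlhom (M N : xleib) := XLHom {
  xlh_top : lhom (xl_top M) (xl_top N);
  xlh_base : lhom (xl_base M) (xl_base N);
  xlh_comm : forall q, xl_map N (xlh_top q) = xlh_base (xl_map M q);
  xlh_actl : forall g q,
    xlh_top (lactl (xl_act M) g q) = lactl (xl_act N) (xlh_base g) (xlh_top q);
  xlh_actr : forall q g,
    xlh_top (lactr (xl_act M) q g) = lactr (xl_act N) (xlh_top q) (xlh_base g)
}.

Lemma xlhom_eq M N (f g : xlhom M N) :
  xlh_top f =1 xlh_top g -> xlh_base f =1 xlh_base g -> f = g.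
Proof.
case: f g => [f1 f2 a b c] [g1 g2 a' b' c'] /= /lhom_eq e1 /lhom_eq e2; subst.
by congr XLHom; exact: Prop_irrelevance.
Qed.

Definition xlid (M : xleib) : xlhom M M :=
  @XLHom M M (lid _) (lid _) (fun=> erefl) (fun _ _ => erefl)
    (fun _ _ => erefl).

Section XlComp.
Variables (M N P : xleib) (g : xlhom N P) (f : xlhom M N).

Let top := lcomp (xlh_top g) (xlh_top f).
Let base := lcomp (xlh_base g) (xlh_base f).

Lemma xlcomp_comm q : xl_map P (top q) = base (xl_map M q).
Proof. by rewrite /= !xlh_comm. Qed.
Lemma xlcomp_actl x q :
  top (lactl (xl_act M) x q) = lactl (xl_act P) (base x) (top q).
Proof. by rewrite /= !xlh_actl. Qed.
Lemma xlcomp_actr q x :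
  top (lactr (xl_act M) q x) = lactr (xl_act P) (top q) (base x).
Proof. by rewrite /= !xlh_actr. Qed.

Definition xlcomp : xlhom M P := XLHom xlcomp_comm xlcomp_actl xlcomp_actr.

End XlComp.

Lemma xlcompA M N P Q (h : xlhom P Q) (g : xlhom N P) (f : xlhom M N) :
  xlcomp h (xlcomp g f) = xlcomp (xlcomp h g) f.
Proof. exact: xlhom_eq. Qed.

Lemma xlcomp1l M N (f : xlhom M N) : xlcomp (xlid N) f = f.
Proof. exact: xlhom_eq. Qed.

Lemma xlcomp1r M N (f : xlhom M N) : xlcomp f (xlid M) = f.
Proof. exact: xlhom_eq. Qed.

Definition XLb : category := Category xlcompA xlcomp1l xlcomp1r.

End Leibniz.

Arguments lbr {k l}.

Section ZeroObjects.
Variable k : comPzRingType.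

Definition zero_fun (A B C : lmodType k) (_ : A) (_ : B) : C := 0.

Lemma zero_fun_bilinear (A B C : lmodType k) : bilinear_op (@zero_fun A B C).
Proof. by split=> w a u v; rewrite /zero_fun scaler0 addr0. Qed.

Definition zero_bimap (A B C : lmodType k) : bimap A B C :=
  Bimap (@zero_fun_bilinear A B C).

Definition zero_map (A B : lmodType k) : {linear A -> B} :=
  (\0 : {linear A -> B}).

Definition dias0 : dialgebra k :=
  @Dialgebra k unit (fun=> zero_bimap unit unit unit)
    (fun _ _ _ => And5 erefl erefl erefl erefl erefl).

Definition leib0 : leibniz k :=
  @Leibniz k unit (zero_bimap unit unit unit) (fun _ _ _ => erefl).

End ZeroObjects.

Section J.
Variable k : comPzRingType.

Section Objects.
Variable D : dialgebra k.

Lemma dias0_homM s (x y : dias0 k) :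
  zero_map (dias0 k) D (dmul s x y) =
  dmul s (zero_map (dias0 k) D x) (zero_map (dias0 k) D y).
Proof. by rewrite /= bop0l. Qed.

Definition dias0_hom : dhom (dias0 k) D := @DHom k (dias0 k) D _ dias0_homM.

Definition dias0_act : dias_action D (dias0 k) :=
  @DiasAction k D (dias0 k)
    (fun=> zero_bimap D unit unit) (fun=> zero_bimap unit D unit)
    (fun _ _ _ => And5 erefl erefl erefl erefl erefl)
    (fun _ _ _ => And5 erefl erefl erefl erefl erefl)
    (fun _ _ _ => And5 erefl erefl erefl erefl erefl)
    (fun _ _ _ => And5 erefl erefl erefl erefl erefl)
    (fun _ _ _ => And5 erefl erefl erefl erefl erefl)
    (fun _ _ _ => And5 erefl erefl erefl erefl erefl).

Definition dias_self_act : dias_action D D :=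
  @DiasAction k D D (@dmul k D) (@dmul k D)
    (@dmulP k D) (@dmulP k D) (@dmulP k D) (@dmulP k D) (@dmulP k D)
    (@dmulP k D).

Lemma J0_equivl s x l :
  dias0_hom (dactl dias0_act s x l) = dmul s x (dias0_hom l).
Proof. by rewrite /= bop0r. Qed.
Lemma J0_equivr s l x :
  dias0_hom (dactr dias0_act s l x) = dmul s (dias0_hom l) x.
Proof. by rewrite /= bop0l. Qed.

Definition J0_obj : xdias k :=
  @XDiasObj k (dias0 k) D dias0_hom dias0_act J0_equivl J0_equivr
    (fun _ _ _ => erefl) (fun _ _ _ => erefl).

Definition J1_obj : xdias k :=
  @XDiasObj k D D (did D) dias_self_act (fun _ _ _ => erefl)
    (fun _ _ _ => erefl) (fun _ _ _ => erefl) (fun _ _ _ => erefl).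

Variable g : leibniz k.

Lemma leib0_homM (x y : leib0 k) :
  zero_map (leib0 k) g (lbr x y) =
  lbr (zero_map (leib0 k) g x) (zero_map (leib0 k) g y).
Proof. by rewrite /= bop0l. Qed.

Definition leib0_hom : lhom (leib0 k) g := @LHom k (leib0 k) g _ leib0_homM.

Definition leib0_act : leib_action g (leib0 k) :=
  @LeibAction k g (leib0 k) (zero_bimap g unit unit) (zero_bimap unit g unit)
    (fun _ _ _ => erefl) (fun _ _ _ => erefl) (fun _ _ _ => erefl)
    (fun _ _ _ => erefl) (fun _ _ _ => erefl) (fun _ _ _ => erefl).

Definition leib_self_act : leib_action g g :=
  @LeibAction k g g lbr lbr (@lbrP k g) (@lbrP k g) (@lbrP k g) (@lbrP k g)
    (@lbrP k g) (@lbrP k g).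

Lemma J'0_equivl x q : leib0_hom (lactl leib0_act x q) = lbr x (leib0_hom q).
Proof. by rewrite /= bop0r. Qed.
Lemma J'0_equivr q x : leib0_hom (lactr leib0_act q x) = lbr (leib0_hom q) x.
Proof. by rewrite /= bop0l. Qed.

Definition J'0_obj : xleib k :=
  @XLeibObj k (leib0 k) g leib0_hom leib0_act J'0_equivl J'0_equivr
    (fun _ _ => erefl) (fun _ _ => erefl).

Definition J'1_obj : xleib k :=
  @XLeibObj k g g (lid g) leib_self_act (fun _ _ => erefl)
    (fun _ _ => erefl) (fun _ _ => erefl) (fun _ _ => erefl).

End Objects.

Lemma J0_comm (D E : dialgebra k) (f : dhom D E) (l : dias0 k) :
  dias0_hom E l = f (dias0_hom D l).
Proof. by rewrite /= linear0. Qed.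

Definition J0_map (D E : dialgebra k) (f : dhom D E) :
    xdhom (J0_obj D) (J0_obj E) :=
  @XDHom k (J0_obj D) (J0_obj E) (did _) f (J0_comm f)
    (fun _ _ _ => erefl) (fun _ _ _ => erefl).

Definition J1_map (D E : dialgebra k) (f : dhom D E) :
    xdhom (J1_obj D) (J1_obj E) :=
  @XDHom k (J1_obj D) (J1_obj E) f f (fun=> erefl) (dhomM f) (dhomM f).

Lemma J'0_comm (g h : leibniz k) (f : lhom g h) (q : leib0 k) :
  leib0_hom h q = f (leib0_hom g q).
Proof. by rewrite /= linear0. Qed.

Definition J'0_map (g h : leibniz k) (f : lhom g h) :
    xlhom (J'0_obj g) (J'0_obj h) :=
  @XLHom k (J'0_obj g) (J'0_obj h) (lid _) f (J'0_comm f)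
    (fun _ _ => erefl) (fun _ _ => erefl).

Definition J'1_map (g h : leibniz k) (f : lhom g h) :
    xlhom (J'1_obj g) (J'1_obj h) :=
  @XLHom k (J'1_obj g) (J'1_obj h) f f (fun=> erefl) (lhomM f) (lhomM f).

Lemma J0_id (D : Dias k) : J0_map (idc D) = idc (J0_obj D : XDias k).
Proof. exact: xdhom_eq. Qed.
Lemma J0_comp (C D E : Dias k) (g : hom D E) (f : hom C D) :
  J0_map (compc g f) = compc (J0_map g : hom (_ : XDias k) _) (J0_map f).
Proof. exact: xdhom_eq. Qed.

Definition J0 : functor (Dias k) (XDias k) :=
  @Functor (Dias k) (XDias k) J0_obj J0_map J0_id J0_comp.

Lemma J1_id (D : Dias k) : J1_map (idc D) = idc (J1_obj D : XDias k).
Proof. exact: xdhom_eq. Qed.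
Lemma J1_comp (C D E : Dias k) (g : hom D E) (f : hom C D) :
  J1_map (compc g f) = compc (J1_map g : hom (_ : XDias k) _) (J1_map f).
Proof. exact: xdhom_eq. Qed.

Definition J1 : functor (Dias k) (XDias k) :=
  @Functor (Dias k) (XDias k) J1_obj J1_map J1_id J1_comp.

Lemma J'0_id (g : Lb k) : J'0_map (idc g) = idc (J'0_obj g : XLb k).
Proof. exact: xlhom_eq. Qed.
Lemma J'0_comp (f g h : Lb k) (b : hom g h) (a : hom f g) :
  J'0_map (compc b a) = compc (J'0_map b : hom (_ : XLb k) _) (J'0_map a).
Proof. exact: xlhom_eq. Qed.

Definition J'0 : functor (Lb k) (XLb k) :=
  @Functor (Lb k) (XLb k) J'0_obj J'0_map J'0_id J'0_comp.

Lemma J'1_id (g : Lb k) : J'1_map (idc g) = idc (J'1_obj g : XLb k).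
Proof. exact: xlhom_eq. Qed.
Lemma J'1_comp (f g h : Lb k) (b : hom g h) (a : hom f g) :
  J'1_map (compc b a) = compc (J'1_map b : hom (_ : XLb k) _) (J'1_map a).
Proof. exact: xlhom_eq. Qed.

Definition J'1 : functor (Lb k) (XLb k) :=
  @Functor (Lb k) (XLb k) J'1_obj J'1_map J'1_id J'1_comp.

End J.

Section UnivEnv.
Variable k : comPzRingType.

Section Objects.
Variable g : leibniz k.

Definition ud_relations : set (free_dias g) :=
  [set free_gen (lbr x y) - dmul Lft (free_gen x) (free_gen y)
       + dmul Rgt (free_gen y) (free_gen x) | x in [set: g] & y in [set: g]].

Definition ud : dialgebra k := quot_dias (gen_ideal ud_relations).

Definition ud_unit : {linear g -> ud} :=
  quot_pi (gen_ideal ud_relations) \o (@free_gen k g).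

Lemma ud_unitM (x y : g) : ud_unit (lbr x y) =
  dmul Lft (ud_unit x) (ud_unit y) - dmul Rgt (ud_unit y) (ud_unit x).
Proof.
have : quot_pi (gen_ideal ud_relations) (free_gen (lbr x y)
    - dmul Lft (free_gen x) (free_gen y)
    + dmul Rgt (free_gen y) (free_gen x)) = 0.
  apply/quot_pi0; apply: (@gen_ideal_sub k _ ud_relations).
  by exists x => //; exists y.
rewrite linearD linearB !dhomM => H.
by apply/eqP; rewrite -subr_eq0 opprB addrA addrAC; apply/eqP.
Qed.

Section Lift.
Variables (D : dialgebra k) (f : {linear g -> D}).
Hypothesis fM : forall x y,
  f (lbr x y) = dmul Lft (f x) (f y) - dmul Rgt (f y) (f x).

Lemma ud_lift_subproof r :
  ideal_set (gen_ideal ud_relations) r -> free_lift f r = 0.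
Proof.
apply: gen_ideal_ker => _ [x _ [y _ <-]].
rewrite linearD linearB !dhomM !free_liftE fM.
by rewrite addrAC subrK subrr.
Qed.

Definition ud_lift : dhom ud D := quot_lift ud_lift_subproof.

Lemma ud_liftE x : ud_lift (ud_unit x) = f x.
Proof. by rewrite [LHS]quot_liftE free_liftE. Qed.

End Lift.

Lemma ud_hom_eq (D : dialgebra k) (f f' : dhom ud D) :
  (forall x, f (ud_unit x) = f' (ud_unit x)) -> f = f'.
Proof.
move=> ff'; apply: quot_hom_eq => x.
have /(congr1 (fun h : dhom _ _ => h x)) := @free_hom_eq k g D
  (dcomp f (quot_pi _)) (dcomp f' (quot_pi _)) ff'.
exact.
Qed.

End Objects.

Lemma ud_map_subproof (g h : leibniz k) (f : lhom g h) (x y : g) :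
  (ud_unit h \o f) (lbr x y) =
  dmul Lft ((ud_unit h \o f) x) ((ud_unit h \o f) y) -
  dmul Rgt ((ud_unit h \o f) y) ((ud_unit h \o f) x).
Proof. by rewrite [LHS]/= lhomM; exact: ud_unitM. Qed.

Definition ud_map (g h : leibniz k) (f : lhom g h) : dhom (ud g) (ud h) :=
  @ud_lift g (ud h) (ud_unit h \o f) (ud_map_subproof f).

Lemma ud_mapE (g h : leibniz k) (f : lhom g h) x :
  ud_map f (ud_unit g x) = ud_unit h (f x).
Proof. exact: ud_liftE. Qed.

Lemma ud_map_id (g : leibniz k) : ud_map (lid g) = did (ud g).
Proof. by apply: ud_hom_eq => x; rewrite ud_mapE. Qed.

Lemma ud_map_comp (f g h : leibniz k) (b : lhom g h) (a : lhom f g) :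
  ud_map (lcomp b a) = dcomp (ud_map b) (ud_map a).
Proof.
by apply: ud_hom_eq => x; rewrite [RHS]/= !ud_mapE.
Qed.

Definition Ud : functor (Lb k) (Dias k) :=
  @Functor (Lb k) (Dias k) ud ud_map ud_map_id ud_map_comp.

End UnivEnv.

Section SpanProduct.
Variables (k : comPzRingType) (D : dialgebra k).

Definition dspan_mul s (A B : set D) : set D :=
  kspan [set dmul s x y | x in A & y in B].

Lemma dspan_gen s (A B : set D) x y : A x -> B y ->
  dspan_mul s A B (dmul s x y).
Proof. by move=> Ax By; apply: sub_gen_smallest; exists x => //; exists y. Qed.

Lemma dspan_mull s r (A B : set D) x y : is_ideal A -> is_ideal B ->
  dspan_mul s A B x -> exists p, dspan_mul p A B (dmul r x y).
Proof.
move=> _ [_ Bm] sx.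
pose p := match s, r with Lft, Lft => Lft | _, _ => Rgt end; exists p.
have mulB v q : B v -> B (dmul q v y) by case/(Bm v y) => *; case: q.
suff H : dspan_mul s A B `<=` [set x | dspan_mul p A B (dmul r x y)].
  exact: H.
apply: kspan_sub.
  have /submod_closedE[S0 SP] := kspan_submod [set dmul p x y | x in A & y in B].
  apply/submod_closedE; split=> /= [|a u v u1 v1]; first by rewrite bop0l.
  by rewrite bopPl; exact: SP.
move=> _ [u Au [v Bv <-]] /=.
case: (dmulP u v y) => e1 e2 e3 e4 e5.
rewrite {}/p; case: s r {sx} => [] [];
  by rewrite (e2, e4, e3, e5); apply: dspan_gen => //; exact: mulB.
Qed.

Lemma dspan_mulr s r (A B : set D) x y : is_ideal A -> is_ideal B ->
  dspan_mul s A B x -> exists p, dspan_mul p A B (dmul r y x).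
Proof.
move=> [_ Am] _ sx.
pose p := match s, r with Rgt, Rgt => Rgt | _, _ => Lft end; exists p.
have mulA v q : A v -> A (dmul q y v) by case/(Am v y) => *; case: q.
suff H : dspan_mul s A B `<=` [set x | dspan_mul p A B (dmul r y x)].
  exact: H.
apply: kspan_sub.
  have /submod_closedE[S0 SP] := kspan_submod [set dmul p x y | x in A & y in B].
  apply/submod_closedE; split=> /= [|a u v u1 v1]; first by rewrite bop0r.
  by rewrite bopPr; exact: SP.
move=> _ [u Au [v Bv <-]] /=.
case: (dmulP y u v) => e1 e2 e3 e4 e5.
rewrite {}/p; case: s r {sx} => [] [].
- by rewrite -e2; apply: dspan_gen => //; exact: mulA.
- by rewrite -e3; apply: dspan_gen => //; exact: mulA.
- by rewrite -e1; apply: dspan_gen => //; exact: mulA.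
- by rewrite -e5; apply: dspan_gen => //; exact: mulA.
Qed.

(* A ⊣ B + B ⊣ A + A ⊢ B + B ⊢ A, each term being the span of the products. *)
Definition cross_mul (A B : set D) : set D :=
  setadd (setadd (setadd (dspan_mul Lft A B) (dspan_mul Lft B A))
    (dspan_mul Rgt A B)) (dspan_mul Rgt B A).

Lemma cross_mul_submod (A B : set D) : submod_closed (mem (cross_mul A B)).
Proof. by do !apply: setadd_submod; exact: kspan_submod. Qed.

Lemma cross_mul_sub (A B C : set D) : submod_closed (mem C) ->
  (forall s, dspan_mul s A B `<=` C) -> (forall s, dspan_mul s B A `<=` C) ->
  cross_mul A B `<=` C.
Proof.
move=> /submod_closedE[_ CP] AB BA x.
have CD u v : C u -> C v -> C (u + v).
  by move=> Cu Cv; rewrite -[u]scale1r; exact: CP.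
case=> _ [_ [u Lu [v Lv <-]] [w Rw <-]] [z Rz <-].
apply: (CD); last exact: (BA Rgt).
apply: (CD); last exact: (AB Rgt).
by apply: (CD); [exact: (AB Lft) | exact: (BA Lft)].
Qed.

Lemma dspan_cross (A B : set D) s :
  dspan_mul s A B `<=` cross_mul A B /\ dspan_mul s B A `<=` cross_mul A B.
Proof.
have z (S : set D) : kspan S 0.
  by have /submod_closedE[] := kspan_submod S.
split=> x sx; case: s sx => sx.
- exists x; last by exists 0; [exact: z|rewrite addr0].
  exists x; last by exists 0; [exact: z|rewrite addr0].
  by exists x => //; exists 0; [exact: z|rewrite addr0].
- exists x; last by exists 0; [exact: z|rewrite addr0].
  exists 0; last by exists x; [|rewrite add0r].
  by exists 0; [exact: z|exists 0; [exact: z|rewrite addr0]].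
- exists x; last by exists 0; [exact: z|rewrite addr0].
  exists x; last by exists 0; [exact: z|rewrite addr0].
  by exists 0; [exact: z|exists x => //; rewrite add0r].
- exists 0; last by exists x => //; rewrite add0r.
  exists 0; last by exists 0; [exact: z|rewrite addr0].
  by exists 0; [exact: z|exists 0; [exact: z|rewrite addr0]].
Qed.

Lemma cross_mul_ideal (A B : set D) : is_ideal A -> is_ideal B ->
  is_ideal (cross_mul A B).
Proof.
move=> iA iB; split=> [|x y]; first exact: cross_mul_submod.
suff /(_ x) H : cross_mul A B `<=` [set x |
    forall s, cross_mul A B (dmul s x y) /\ cross_mul A B (dmul s y x)].
  by move=> /H Hx; case: (Hx Lft) (Hx Rgt) => ? ? [].
apply: cross_mul_sub => [|s u su r|s u su r] /=.
- have /submod_closedE[S0 SP] := cross_mul_submod A B.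
  apply/submod_closedE; split=> /= [s|a u v uX vX s].
    by rewrite bop0l bop0r.
  by case: (uX s) (vX s) => ? ? [? ?]; rewrite bopPl bopPr; split; exact: SP.
- have [p Hp] := dspan_mull r y iA iB su; have [q Hq] := dspan_mulr r y iA iB su.
  by split; [exact: (dspan_cross A B p).1|exact: (dspan_cross A B q).1].
- have [p Hp] := dspan_mull r y iB iA su; have [q Hq] := dspan_mulr r y iB iA su.
  by split; [exact: (dspan_cross A B p).2|exact: (dspan_cross A B q).2].
Qed.

Lemma cross_mul_gen s (A B : set D) x y : A x -> B y ->
  cross_mul A B (dmul s x y) /\ cross_mul A B (dmul s y x).
Proof.
by move=> Ax By; split; [apply: (dspan_cross A B s).1|
  apply: (dspan_cross A B s).2]; exact: dspan_gen.
Qed.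

Lemma cross_mul_min (A B I : set D) : is_ideal I ->
  (forall s x y, A x -> B y -> I (dmul s x y) /\ I (dmul s y x)) ->
  cross_mul A B `<=` I.
Proof.
move=> [iI _] ABI; apply: cross_mul_sub => // s; apply: kspan_sub => //.
- by move=> _ [x Ax [y By <-]]; exact: (ABI s x y Ax By).1.
- by move=> _ [x Bx [y Ay <-]]; exact: (ABI s y x Ay Bx).2.
Qed.

End SpanProduct.

Section KernelAction.
Variables (k : comPzRingType) (B D E : dialgebra k).
Variables (f : dhom D E) (i : dhom B D).

Definition ker_actl_fun s (b : B) (x : ker_dias f) : ker_dias f :=
  ker_elt (ker_mulr s (i b) (kerP x)).
Definition ker_actr_fun s (x : ker_dias f) (b : B) : ker_dias f :=
  ker_elt (ker_mull s (i b) (kerP x)).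

Lemma ker_actl_bilinear s : bilinear_op (ker_actl_fun s).
Proof.
by split=> w a u v; apply: val_inj; rewrite /= ?linearP (bopPl, bopPr).
Qed.
Lemma ker_actr_bilinear s : bilinear_op (ker_actr_fun s).
Proof.
by split=> w a u v; apply: val_inj; rewrite /= ?linearP (bopPl, bopPr).
Qed.

Definition ker_actl s := Bimap (ker_actl_bilinear s).
Definition ker_actr s := Bimap (ker_actr_bilinear s).

Lemma ker_act_DLL : dias_identities ker_actl dmul dmul ker_actl.
Proof.
by move=> x y z; case: (dmulP (i x) (val y) (val z)) => *;
  split; apply: val_inj; rewrite /= ?dhomM.
Qed.
Lemma ker_act_LDL : dias_identities ker_actr dmul ker_actl dmul.
Proof.
by move=> x y z; case: (dmulP (val x) (i y) (val z)) => *;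
  split; apply: val_inj; rewrite /= ?dhomM.
Qed.
Lemma ker_act_LLD : dias_identities dmul ker_actr ker_actr dmul.
Proof.
by move=> x y z; case: (dmulP (val x) (val y) (i z)) => *;
  split; apply: val_inj; rewrite /= ?dhomM.
Qed.
Lemma ker_act_LDD : dias_identities ker_actr ker_actr dmul ker_actr.
Proof.
by move=> x y z; case: (dmulP (val x) (i y) (i z)) => *;
  split; apply: val_inj; rewrite /= ?dhomM.
Qed.
Lemma ker_act_DLD : dias_identities ker_actl ker_actr ker_actr ker_actl.
Proof.
by move=> x y z; case: (dmulP (i x) (val y) (i z)) => *;
  split; apply: val_inj; rewrite /= ?dhomM.
Qed.
Lemma ker_act_DDL : dias_identities dmul ker_actl ker_actl ker_actl.
Proof.
by move=> x y z; case: (dmulP (i x) (i y) (val z)) => *;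
  split; apply: val_inj; rewrite /= ?dhomM.
Qed.

Definition ker_act : dias_action B (ker_dias f) :=
  DiasAction ker_act_DLL ker_act_LDL ker_act_LLD ker_act_LDD ker_act_DLD
    ker_act_DDL.

End KernelAction.

Section KernelMap.
Variables (k : comPzRingType) (D E D' E' : dialgebra k).
Variables (f : dhom D E) (f' : dhom D' E') (h : dhom D D') (e : dhom E E').
Hypothesis fh : forall x, f' (h x) = e (f x).

Lemma ker_map_subproof (x : ker_dias f) : f' (h (val x)) = 0.
Proof. by rewrite fh kerP linear0. Qed.

Definition ker_map_fun (x : ker_dias f) : ker_dias f' :=
  ker_elt (ker_map_subproof x).

Lemma ker_map_linear : linear ker_map_fun.
Proof. by move=> a x y; apply: val_inj; rewrite /= linearP. Qed.

HB.instance Definition _ := GRing.isLinear.Build k (ker_dias f) (ker_dias f')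
  *:%R ker_map_fun ker_map_linear.

Lemma ker_mapM s x y :
  ker_map_fun (dmul s x y) = dmul s (ker_map_fun x) (ker_map_fun y).
Proof. by apply: val_inj; rewrite /= dhomM. Qed.

Definition ker_map : dhom (ker_dias f) (ker_dias f') :=
  @DHom k _ _ (ker_map_fun : {linear ker_dias f -> ker_dias f'}) ker_mapM.

End KernelMap.

Section XUdObject.
Variables (k : comPzRingType) (M : xleib k).

Local Notation q := (xl_top M).
Local Notation g := (xl_base M).

Definition xl_sd : leibniz k := semidirect (xl_act M).

Definition sd_src_fun (x : xl_sd) : g := x.2.
Definition sd_tgt_fun (x : xl_sd) : g := xl_map M x.1 + x.2.
Definition sd_sec_fun (x : g) : xl_sd := (0, x).

Lemma sd_src_linear : linear sd_src_fun.
Proof. by []. Qed.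
Lemma sd_tgt_linear : linear sd_tgt_fun.
Proof. by move=> a x y; rewrite /sd_tgt_fun linearP scalerDr addrACA. Qed.
Lemma sd_sec_linear : linear sd_sec_fun.
Proof. by move=> a x y; congr pair; rewrite /= scaler0 addr0. Qed.

HB.instance Definition _ :=
  GRing.isLinear.Build k xl_sd g *:%R sd_src_fun sd_src_linear.
HB.instance Definition _ :=
  GRing.isLinear.Build k xl_sd g *:%R sd_tgt_fun sd_tgt_linear.
HB.instance Definition _ :=
  GRing.isLinear.Build k g xl_sd *:%R sd_sec_fun sd_sec_linear.

Lemma sd_srcM (x y : xl_sd) :
  sd_src_fun (lbr x y) = lbr (sd_src_fun x) (sd_src_fun y).
Proof. by []. Qed.
Lemma sd_tgtM (x y : xl_sd) :
  sd_tgt_fun (lbr x y) = lbr (sd_tgt_fun x) (sd_tgt_fun y).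
Proof.
rewrite /sd_tgt_fun /= !linearD lhomM xl_equivl xl_equivr.
by rewrite !bopDl !bopDr !addrA.
Qed.
Lemma sd_secM (x y : g) :
  sd_sec_fun (lbr x y) = lbr (sd_sec_fun x) (sd_sec_fun y).
Proof. by congr pair; rewrite /= !(bop0l, bop0r) !addr0. Qed.

Definition sd_src : lhom xl_sd g :=
  @LHom k xl_sd g (sd_src_fun : {linear xl_sd -> g}) sd_srcM.
Definition sd_tgt : lhom xl_sd g :=
  @LHom k xl_sd g (sd_tgt_fun : {linear xl_sd -> g}) sd_tgtM.
Definition sd_sec : lhom g xl_sd :=
  @LHom k g xl_sd (sd_sec_fun : {linear g -> xl_sd}) sd_secM.

Lemma ud_src_sec x : ud_map sd_src (ud_map sd_sec x) = x.
Proof.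
have e : lcomp sd_src sd_sec = lid g by exact: lhom_eq.
by have := congr1 (fun f : dhom _ _ => f x) (ud_map_comp sd_src sd_sec); rewrite e ud_map_id.
Qed.

Lemma ud_tgt_sec x : ud_map sd_tgt (ud_map sd_sec x) = x.
Proof.
have e : lcomp sd_tgt sd_sec = lid g.
  by apply: lhom_eq => y; rewrite /= /sd_tgt_fun /= linear0 add0r.
by have := congr1 (fun f : dhom _ _ => f x) (ud_map_comp sd_tgt sd_sec); rewrite e ud_map_id.
Qed.

Definition xud_ideal_set : set (ud xl_sd) :=
  cross_mul (dker (ud_map sd_src)) (dker (ud_map sd_tgt)).

Definition xud_ideal : ideal (ud xl_sd) :=
  Ideal (cross_mul_ideal (dker_ideal (ud_map sd_src))
    (dker_ideal (ud_map sd_tgt))).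

Definition xud_quot : dialgebra k := quot_dias xud_ideal.

Lemma xud_src_subproof x : ideal_set xud_ideal x -> ud_map sd_src x = 0.
Proof.
apply: (cross_mul_min (dker_ideal _)) => s u v uS vT.
by split; rewrite /dker /mkset dhomM (uS : _ = 0) (bop0l, bop0r).
Qed.
Lemma xud_tgt_subproof x : ideal_set xud_ideal x -> ud_map sd_tgt x = 0.
Proof.
apply: (cross_mul_min (dker_ideal _)) => s u v uS vT.
by split; rewrite /dker /mkset dhomM (vT : _ = 0) (bop0l, bop0r).
Qed.

Definition xud_src : dhom xud_quot (ud g) := quot_lift xud_src_subproof.
Definition xud_tgt : dhom xud_quot (ud g) := quot_lift xud_tgt_subproof.
Definition xud_sec : dhom (ud g) xud_quot :=
  dcomp (quot_pi xud_ideal) (ud_map sd_sec).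

Lemma xud_tgt_sec x : xud_tgt (xud_sec x) = x.
Proof. by rewrite [LHS]quot_liftE ud_tgt_sec. Qed.

Definition xud_top : dialgebra k := ker_dias xud_src.
Definition xud_map : dhom xud_top (ud g) := dcomp xud_tgt (ker_incl xud_src).
Definition xud_act : dias_action (ud g) xud_top := ker_act xud_src xud_sec.

Lemma xud_cross s (a b : xud_quot) : xud_src b = 0 ->
  dmul s (xud_sec (xud_tgt a)) b = dmul s a b /\
  dmul s b (xud_sec (xud_tgt a)) = dmul s b a.
Proof.
have [A <-] := quot_pi_surj a; have [B <-] := quot_pi_surj b.
rewrite (quot_liftE xud_src_subproof) (quot_liftE xud_tgt_subproof) => SB.
have TA : dker (ud_map sd_tgt) (ud_map sd_sec (ud_map sd_tgt A) - A).
  by rewrite /dker /mkset linearB ud_tgt_sec subrr.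
have [XBA XAB] := cross_mul_gen s (SB : dker (ud_map sd_src) B) TA.
have secE y : xud_sec y = quot_pi xud_ideal (ud_map sd_sec y) by [].
rewrite secE; split; rewrite -!dhomM; apply/subr0_eq; rewrite -linearB.
- by rewrite -bopBl; apply/quot_pi0.
- by rewrite -bopBr; apply/quot_pi0.
Qed.

Lemma xud_equivl s x l : xud_map (dactl xud_act s x l) = dmul s x (xud_map l).
Proof. by rewrite [LHS](dhomM xud_tgt) xud_tgt_sec. Qed.
Lemma xud_equivr s l x : xud_map (dactr xud_act s l x) = dmul s (xud_map l) x.
Proof. by rewrite [LHS](dhomM xud_tgt) xud_tgt_sec. Qed.
Lemma xud_peifferl s l l' : dactl xud_act s (xud_map l) l' = dmul s l l'.
Proof. by apply: val_inj; exact: (xud_cross s (val l) (kerP l')).1. Qed.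
Lemma xud_peifferr s l l' : dactr xud_act s l (xud_map l') = dmul s l l'.
Proof. by apply: val_inj; exact: (xud_cross s (val l') (kerP l)).2. Qed.

Definition xud : xdias k :=
  XDiasObj xud_equivl xud_equivr xud_peifferl xud_peifferr.

End XUdObject.

Section XUdMap.
Variables (k : comPzRingType) (M N : xleib k) (f : xlhom M N).

Definition sd_map_fun (x : xl_sd M) : xl_sd N :=
  (xlh_top f x.1, xlh_base f x.2).

Lemma sd_map_linear : linear sd_map_fun.
Proof. by move=> a x y; congr pair; rewrite /= linearP. Qed.

HB.instance Definition _ :=
  GRing.isLinear.Build k (xl_sd M) (xl_sd N) *:%R sd_map_fun sd_map_linear.

Lemma sd_mapM (x y : xl_sd M) :
  sd_map_fun (lbr x y) = lbr (sd_map_fun x) (sd_map_fun y).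
Proof.
by congr pair; rewrite /= ?linearD lhomM // xlh_actl xlh_actr.
Qed.

Definition sd_map : lhom (xl_sd M) (xl_sd N) :=
  @LHom k (xl_sd M) (xl_sd N) (sd_map_fun : {linear xl_sd M -> xl_sd N})
    sd_mapM.

Lemma ud_src_map x :
  ud_map (sd_src N) (ud_map sd_map x) = ud_map (xlh_base f) (ud_map (sd_src M) x).
Proof.
have e : lcomp (sd_src N) sd_map = lcomp (xlh_base f) (sd_src M).
  exact: lhom_eq.
by have := congr1 (fun h => ud_map h x) e; rewrite !ud_map_comp.
Qed.

Lemma ud_tgt_map x :
  ud_map (sd_tgt N) (ud_map sd_map x) = ud_map (xlh_base f) (ud_map (sd_tgt M) x).
Proof.
have e : lcomp (sd_tgt N) sd_map = lcomp (xlh_base f) (sd_tgt M).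
  by apply: lhom_eq => y; rewrite /= /sd_tgt_fun /= xlh_comm linearD.
by have := congr1 (fun h => ud_map h x) e; rewrite !ud_map_comp.
Qed.

Lemma ud_sec_map x :
  ud_map sd_map (ud_map (sd_sec M) x) = ud_map (sd_sec N) (ud_map (xlh_base f) x).
Proof.
have e : lcomp sd_map (sd_sec M) = lcomp (sd_sec N) (xlh_base f).
  by apply: lhom_eq => y; congr pair; rewrite /= linear0.
by have := congr1 (fun h => ud_map h x) e; rewrite !ud_map_comp.
Qed.

Lemma xud_quot_map_subproof x : ideal_set (xud_ideal M) x ->
  dcomp (quot_pi (xud_ideal N)) (ud_map sd_map) x = 0.
Proof.
apply: (cross_mul_min (dker_ideal _)) => s u v uS vT.
have uS' : dker (ud_map (sd_src N)) (ud_map sd_map u).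
  by rewrite /dker /mkset ud_src_map (uS : _ = 0) linear0.
have vT' : dker (ud_map (sd_tgt N)) (ud_map sd_map v).
  by rewrite /dker /mkset ud_tgt_map (vT : _ = 0) linear0.
have [? ?] := cross_mul_gen s uS' vT'.
by split; apply/quot_pi0; rewrite dhomM.
Qed.

Definition xud_quot_map : dhom (xud_quot M) (xud_quot N) :=
  quot_lift xud_quot_map_subproof.

Lemma xud_quot_mapE x : xud_quot_map (quot_pi (xud_ideal M) x) =
  quot_pi (xud_ideal N) (ud_map sd_map x).
Proof. exact: quot_liftE. Qed.

Lemma xud_src_map x :
  xud_src N (xud_quot_map x) = ud_map (xlh_base f) (xud_src M x).
Proof.
have [X <-] := quot_pi_surj x; rewrite xud_quot_mapE.
by rewrite !(quot_liftE (@xud_src_subproof _ _)) ud_src_map.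
Qed.

Lemma xud_tgt_map x :
  xud_tgt N (xud_quot_map x) = ud_map (xlh_base f) (xud_tgt M x).
Proof.
have [X <-] := quot_pi_surj x; rewrite xud_quot_mapE.
by rewrite !(quot_liftE (@xud_tgt_subproof _ _)) ud_tgt_map.
Qed.

Lemma xud_sec_map x :
  xud_quot_map (xud_sec M x) = xud_sec N (ud_map (xlh_base f) x).
Proof. by rewrite [LHS]xud_quot_mapE ud_sec_map. Qed.

Definition xud_top_map : dhom (xud_top M) (xud_top N) := ker_map xud_src_map.

Lemma xud_hom_comm l :
  xud_map N (xud_top_map l) = ud_map (xlh_base f) (xud_map M l).
Proof. exact: xud_tgt_map. Qed.
Lemma xud_hom_actl s x l : xud_top_map (dactl (xud_act M) s x l) =
  dactl (xud_act N) s (ud_map (xlh_base f) x) (xud_top_map l).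
Proof.
by apply: val_inj; rewrite [LHS](dhomM xud_quot_map) xud_sec_map.
Qed.
Lemma xud_hom_actr s l x : xud_top_map (dactr (xud_act M) s l x) =
  dactr (xud_act N) s (xud_top_map l) (ud_map (xlh_base f) x).
Proof.
by apply: val_inj; rewrite [LHS](dhomM xud_quot_map) xud_sec_map.
Qed.

Definition xud_hom : xdhom (xud M) (xud N) :=
  @XDHom k (xud M) (xud N) xud_top_map (ud_map (xlh_base f))
    xud_hom_comm xud_hom_actl xud_hom_actr.

End XUdMap.

Section XUdFunctor.
Variable k : comPzRingType.

Lemma xud_hom_id (M : XLb k) : xud_hom (idc M) = idc (xud M : XDias k).
Proof.
apply: xdhom_eq => [x|x]; last first.
  exact: (congr1 (fun h : dhom _ _ => h x) (ud_map_id _)).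
apply: val_inj; rewrite /=.
have [X <-] := quot_pi_surj (val x); rewrite [LHS]xud_quot_mapE.
have -> : sd_map (xlid M) = lid (xl_sd M) by apply: lhom_eq => -[].
by rewrite ud_map_id.
Qed.

Lemma xud_hom_comp (M N P : XLb k) (g : hom N P) (f : hom M N) :
  xud_hom (compc g f) = compc (xud_hom g : hom (_ : XDias k) _) (xud_hom f).
Proof.
apply: xdhom_eq => [x|x]; last first.
  exact: (congr1 (fun h : dhom _ _ => h x) (ud_map_comp _ _)).
apply: val_inj; rewrite /=.
have [X <-] := quot_pi_surj (val x).
rewrite [LHS]xud_quot_mapE [X in _ = _ X]xud_quot_mapE [RHS]xud_quot_mapE.
have -> : sd_map (xlcomp g f) = lcomp (sd_map g) (sd_map f) by exact: lhom_eq.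
by rewrite ud_map_comp.
Qed.

Definition XUd : functor (XLb k) (XDias k) :=
  @Functor (XLb k) (XDias k) (@xud k) (@xud_hom k) xud_hom_id xud_hom_comp.

End XUdFunctor.

(* Main.v *)
(* For J'_1, let Q = U_d(g |>< g) / X, with source s, target t and section
   [sec], and let j : U_d(g) -> Q be induced by the Leibniz homomorphism
   x |-> (x, 0); then s j = 0 and t j = id.  As j p and [sec] p have the same
   target, dividing by X identifies multiplication by j p with multiplication
   by [sec] p on Ker s.  Hence y |-> [sec] (s y) + j (t y) - j (s y) is
   multiplicative on Q; it fixes the generators, so it is the identity, and
   y = j (t y) on Ker s.  Thus t : Ker s -> U_d(g) is inverse to j.
   For J'_0, U_d(s) is invertible, so that Ker s = 0. *)
Require Import Defs.
From HB Require Import structures.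
From mathcomp Require Import all_boot all_algebra.

Set Implicit Arguments.
Unset Strict Implicit.
Unset Printing Implicit Defensive.

Import GRing.Theory.
Local Open Scope ring_scope.

Section Isomorphisms.
Variables (k : comPzRingType) (M N : xdias k) (f : xdhom M N).
Variables (top' : dhom (xd_top N) (xd_top M)).
Variables (base' : dhom (xd_base N) (xd_base M)).
Hypotheses (topK : cancel (xdh_top f) top') (top'K : cancel top' (xdh_top f)).
Hypotheses (baseK : cancel (xdh_base f) base').
Hypotheses (base'K : cancel base' (xdh_base f)).

Lemma xdinv_comm l : xd_map M (top' l) = base' (xd_map N l).
Proof. by rewrite -[LHS]baseK -xdh_comm top'K. Qed.
Lemma xdinv_actl s x l :
  top' (dactl (xd_act N) s x l) = dactl (xd_act M) s (base' x) (top' l).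
Proof. by rewrite -[RHS]topK xdh_actl top'K base'K. Qed.
Lemma xdinv_actr s l x :
  top' (dactr (xd_act N) s l x) = dactr (xd_act M) s (top' l) (base' x).
Proof. by rewrite -[RHS]topK xdh_actr top'K base'K. Qed.

Definition xdinv : xdhom N M := XDHom xdinv_comm xdinv_actl xdinv_actr.

(** Componentwise inverses respect the boundary maps and the actions automatically: apply the
    compatibility of [f] and cancel. So invertibility can be tested on the two components. *)
Lemma xdhom_is_iso : @is_iso (XDias k) M N f.
Proof. by exists xdinv; split; apply: xdhom_eq. Qed.

End Isomorphisms.

Section KernelLift.
Variables (k : comPzRingType) (B D E : dialgebra k).
Variables (f : dhom D E) (h : dhom B D) (fh : forall x, f (h x) = 0).

Definition ker_lift_fun (x : B) : ker_dias f := ker_elt (fh x).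

Lemma ker_lift_linear : linear ker_lift_fun.
Proof. by move=> a x y; apply: val_inj; rewrite /= linearP. Qed.

HB.instance Definition _ := GRing.isLinear.Build k B (ker_dias f)
  *:%R ker_lift_fun ker_lift_linear.

Lemma ker_liftM s x y :
  ker_lift_fun (dmul s x y) = dmul s (ker_lift_fun x) (ker_lift_fun y).
Proof. by apply: val_inj; rewrite /= dhomM. Qed.

(** Corestriction to the kernel; for [xud_inl] it provides the inverse of the target map on
    [Ker s]. *)
Definition ker_lift : dhom B (ker_dias f) :=
  @DHom k _ _ (ker_lift_fun : {linear B -> ker_dias f}) ker_liftM.

End KernelLift.

Section SquareJ0.
Variable k : comPzRingType.

Lemma xud_top_J'0 (g : leibniz k) (x : xud_top (J'0_obj g)) : x = 0.
Proof.
apply: val_inj; rewrite linear0.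
have := kerP x; have [X <-] := quot_pi_surj (val x).
rewrite (quot_liftE (@xud_src_subproof _ _)) => sX0.
(* As the top algebra is zero, [sd_sec] is also a left inverse of [sd_src]; functoriality transports
   this to [ud_map]. *)
have e : lcomp (sd_sec (J'0_obj g)) (sd_src (J'0_obj g)) = lid _.
  by apply: lhom_eq => -[[] y].
have <- : ud_map (sd_sec (J'0_obj g)) (ud_map (sd_src (J'0_obj g)) X) = X.
  have := congr1 (fun h : lhom _ _ => ud_map h X) e.
  by rewrite ud_map_comp ud_map_id.
by rewrite sX0 !linear0.
Qed.

Definition xud_J'0_top (g : leibniz k) : dhom (xud_top (J'0_obj g)) (dias0 k) :=
  @DHom k _ (dias0 k) (zero_map _ (dias0 k)) (fun _ _ _ => erefl).

Lemma xud_J'0_comm (g : leibniz k) (l : xud_top (J'0_obj g)) :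
  dias0_hom (ud g) (xud_J'0_top g l) = xud_map (J'0_obj g) l.
Proof. by rewrite [l]xud_top_J'0 !linear0. Qed.

Definition xud_J'0 (g : leibniz k) : xdhom (xud (J'0_obj g)) (J0_obj (ud g)) :=
  @XDHom k (xud (J'0_obj g)) (J0_obj (ud g)) (xud_J'0_top g) (did _)
    (@xud_J'0_comm g) (fun _ _ _ => erefl) (fun _ _ _ => erefl).

Lemma xud_J'0_natural_iso :
  naturally_isomorphic (fcomp (XUd k) (J'0 k)) (fcomp (J0 k) (Ud k)).
Proof.
(* Naturality holds by computation: the top components land in the zero dialgebra, and both base
   components are [ud_map f]. *)
exists (@xud_J'0); split=> [g|g h f]; last exact: xdhom_eq.
apply: (@xdhom_is_iso _ _ _ (xud_J'0 g) (dias0_hom _) (did _)) => //.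
- by move=> x; rewrite [LHS]xud_top_J'0 [RHS]xud_top_J'0.
- by case.
Qed.

End SquareJ0.

Section SquareJ1.
Variable k : comPzRingType.

Section Object.
Variable g : leibniz k.

Local Notation M := (J'1_obj g).
Local Notation Q := (xud_quot M).
Local Notation src := (xud_src M).
Local Notation tgt := (xud_tgt M).
Local Notation sec := (xud_sec M).

Definition sd_inl_fun (x : g) : xl_sd M := (x, 0).

Lemma sd_inl_linear : linear sd_inl_fun.
Proof. by move=> a x y; congr pair; rewrite /= scaler0 addr0. Qed.

HB.instance Definition _ :=
  GRing.isLinear.Build k g (xl_sd M) *:%R sd_inl_fun sd_inl_linear.

Lemma sd_inlM (x y : g) :
  sd_inl_fun (lbr x y) = lbr (sd_inl_fun x) (sd_inl_fun y).
Proof. by congr pair; rewrite /= !(bop0l, bop0r) ?addr0. Qed.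

Definition sd_inl : lhom g (xl_sd M) :=
  @LHom k g (xl_sd M) (sd_inl_fun : {linear g -> xl_sd M}) sd_inlM.

Definition xud_inl : dhom (ud g) Q := dcomp (quot_pi _) (ud_map sd_inl).

Local Notation j := xud_inl.

Lemma xud_src_inl x : src (j x) = 0.
Proof.
rewrite [LHS]quot_liftE.
(* The zero map is a dialgebra homomorphism, so equality with it can be checked on generators, where
   [s] sends [(y, 0)] to [0]. *)
pose zero : dhom (ud g) (ud g) := @DHom k _ _ (zero_map _ _)
  (fun s x y => esym (bop0l (dmul s) 0)).
have : dcomp (ud_map (sd_src M)) (ud_map sd_inl) = zero.
  rewrite -ud_map_comp; apply: ud_hom_eq => y.
  by rewrite ud_mapE; exact: (linear0 (ud_unit g)).
by move/(congr1 (fun h : dhom _ _ => h x)).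
Qed.

Lemma xud_tgt_inl x : tgt (j x) = x.
Proof.
rewrite [LHS]quot_liftE.
have e : lcomp (sd_tgt M) sd_inl = lid g.
  by apply: lhom_eq => y; rewrite /= /sd_tgt_fun /= addr0.
by have := congr1 (fun h : lhom _ _ => ud_map h x) e;
  rewrite ud_map_comp ud_map_id.
Qed.

(** This is [xud_cross] at [j p], whose target is [p]. *)
Lemma xud_sec_inl s p (x : Q) : src x = 0 ->
  dmul s (sec p) x = dmul s (j p) x /\ dmul s x (sec p) = dmul s x (j p).
Proof. by move=> /(xud_cross s (j p)); rewrite xud_tgt_inl. Qed.

(** Candidate splitting of [y] into a part in the image of [sec] and a part in [Ker s]: the
    difference lies in [Ker s] because [src] kills [j]. *)
Definition xud_decomp (y : Q) : Q := sec (src y) + (j (tgt y) - j (src y)).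

Lemma xud_decomp_linear : linear xud_decomp.
Proof.
move=> a x y; rewrite /xud_decomp !linearP /=.
by rewrite !scalerDr [RHS]addrACA; congr (_ + _); rewrite addrACA.
Qed.

HB.instance Definition _ :=
  GRing.isLinear.Build k Q Q *:%R xud_decomp xud_decomp_linear.

Lemma xud_decompM s x y :
  xud_decomp (dmul s x y) = dmul s (xud_decomp x) (xud_decomp y).
Proof.
have ker z : src (j (tgt z) - j (src z)) = 0.
  by rewrite linearB !xud_src_inl subrr.
rewrite /xud_decomp [RHS]bopDl !(bopDr _ (sec (src y))).
(* In each mixed product the other factor lies in [Ker s], so [sec] may be replaced by [j]. *)
rewrite (xud_sec_inl s _ (ker y)).1 (xud_sec_inl s _ (ker x)).2 !dhomM -addrA.
(* The two products with left factor [j (tgt x) - j (src x)] merge into one with right factor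
   [j (tgt y)]; the rest telescopes. *)
congr (_ + _); rewrite -bopDr addrCA subrr addr0.
by rewrite bopBl bopBr addrC addrA subrK.
Qed.

Definition xud_decomp_hom : dhom Q Q :=
  @DHom k Q Q (xud_decomp : {linear Q -> Q}) xud_decompM.

Definition xud_gen : {linear xl_sd M -> Q} :=
  quot_pi (xud_ideal M) \o ud_unit (xl_sd M).

Lemma xud_src_gen z : src (xud_gen z) = ud_unit g z.2.
Proof. by rewrite (quot_liftE (@xud_src_subproof _ _)) ud_mapE. Qed.

Lemma xud_tgt_gen z : tgt (xud_gen z) = ud_unit g (z.1 + z.2).
Proof. by rewrite (quot_liftE (@xud_tgt_subproof _ _)) ud_mapE. Qed.

Lemma xud_sec_gen x : sec (ud_unit g x) = xud_gen (0, x).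
Proof. exact: congr1 (ud_mapE _ _). Qed.

Lemma xud_inl_gen x : j (ud_unit g x) = xud_gen (x, 0).
Proof. exact: congr1 (ud_mapE _ _). Qed.

Lemma xud_decompE y : xud_decomp y = y.
Proof.
suff e : xud_decomp_hom = did Q by exact: (congr1 (fun h : dhom _ _ => h y) e).
apply: quot_hom_eq => X.
suff e : dcomp xud_decomp_hom (quot_pi _) = quot_pi (xud_ideal M).
  exact: (congr1 (fun h : dhom _ _ => h X) e).
apply: ud_hom_eq => z; rewrite -[RHS]/(xud_gen z).
have -> : dcomp xud_decomp_hom (quot_pi _) (ud_unit _ z) = xud_decomp (xud_gen z).
  by [].
rewrite /xud_decomp xud_src_gen xud_tgt_gen xud_sec_gen !xud_inl_gen.
(* For [z = (a, b)] the target is [a + b], and [(0, b) + ((a + b, 0) - (b, 0)) = (a, b)]. *)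
rewrite -linearB -linearD; congr (xud_gen _); case: z => a b.
congr pair; first exact: etrans (add0r _) (addrK b a).
exact: etrans (congr1 (+%R b) (subrr 0)) (addr0 b).
Qed.

Lemma xud_inlK x : src x = 0 -> j (tgt x) = x.
Proof.
by move=> sx; rewrite -[RHS]xud_decompE /xud_decomp sx !linear0 addr0 add0r.
Qed.

(** The boundary map of a crossed module is itself the top component of a morphism to the identity
    crossed module of its base; equivariance is exactly compatibility with the actions. *)
Definition xud_J'1 : xdhom (xud M) (J1_obj (ud g)) :=
  @XDHom k (xud M) (J1_obj (ud g)) (xud_map M) (did _) (fun=> erefl)
    (@xud_equivl k M) (@xud_equivr k M).

Lemma xud_J'1_iso : @is_iso (XDias k) _ _ xud_J'1.
Proof.
apply: (@xdhom_is_iso _ _ _ xud_J'1 (ker_lift xud_src_inl) (did _)) => //.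
- by move=> x; apply: val_inj; exact: xud_inlK (kerP x).
- exact: xud_tgt_inl.
Qed.

End Object.

Lemma xud_J'1_natural_iso :
  naturally_isomorphic (fcomp (XUd k) (J'1 k)) (fcomp (J1 k) (Ud k)).
Proof.
exists (@xud_J'1); split=> [g|g h f]; first exact: xud_J'1_iso.
(* On top components, naturality says that the induced map of quotients commutes with the
   targets. *)
apply: xdhom_eq => [x|//]; exact: (xud_tgt_map (J'1_map f)).
Qed.

End SquareJ1.

Theorem proposition5p4 (k : comPzRingType) :
  commutative_square (J'0 k) (XUd k) (Ud k) (J0 k) /\
  commutative_square (J'1 k) (XUd k) (Ud k) (J1 k).
Proof. by split; right; [exact: xud_J'0_natural_iso | exact: xud_J'1_natural_iso]. Qed.
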